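(* Let $\mathbb{L} = \{(s,\lambda)\in\mathbb{C}^2 \mid \Re\lambda>0,\ \lambda(j-s)\neq(2k+1)\pi i \text{ for all } j,k\in\mathbb{Z} \text{ with } j\ge 1\}$. For $j\ge1$ put $q_j(s,z)=\dfrac{e^{\mu z}}{1+e^{\lambda(j-s)}}$. Then the function $$\beta_{\lambda,\mu}(s)=\lim_{n\to\infty} q_1\big(s,q_2(s,\dots q_n(s,z)\dots)\big)$$ (the limit being constant in $z\in\mathbb{C}$) is holomorphic for $\mu\in\mathbb{C}$ and $(s,\lambda)\in\mathbb{L}$. Moreover it satisfies the identity $$\beta_{\lambda,\mu}(s+1)=\frac{e^{\mu\beta_{\lambda,\mu}(s)}}{1+e^{-\lambda s}}$$ whenever $(s+1,\lambda)\in\mathbb{L}$.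
   Context: The compositions are nested in the variable $z$ only, with $s,\lambda,\mu$ as parameters: $q_1(s,q_2(s,\dots q_n(s,z)\dots))$ means that $q_n(s,z)$ is substituted for the second argument of $q_{n-1}(s,\cdot)$, and so on. *)

(* Defs.v *)
From Stdlib Require Import Reals ZArith.
From Coquelicot Require Import Coquelicot.

Open Scope C_scope.

Definition Cexp (w : C) : C :=
  (exp (Re w) * cos (Im w), exp (Re w) * sin (Im w))%R.

Definition LL (s lambda : C) : Prop :=
  (0 < Re lambda)%R /\
  forall j k : Z, (1 <= j)%Z ->
    lambda * (RtoC (IZR j) - s) <> RtoC (IZR (2 * k + 1)) * RtoC PI * Ci.

Definition q (lambda mu : C) (j : nat) (s z : C) : C :=
  Cexp (mu * z) / (1 + Cexp (lambda * (RtoC (INR j) - s))).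

(* q_1(s, q_2(s, ... q_n(s, z))): q_n is innermost. *)
Fixpoint nested_q (lambda mu : C) (n : nat) (s z : C) : C :=
  match n with
  | O => z
  | S m => nested_q lambda mu m s (q lambda mu (S m) s z)
  end.

(* The common value, over all z, of the limit of the nested compositions.
   [iota] is a total description operator: this is meaningful only when
   such a value exists. *)
Definition beta (lambda mu s : C) : C :=
  @iota C_CompleteNormedModule (fun l : C => forall z : C,
    filterlim (fun n : nat => nested_q lambda mu n s z) eventually (locally l)).

(* Joint holomorphy: complex Frechet differentiability, the scalar ring of
   [ex_filterdiff] being C, at every point of an open set. *)
Definition holomorphic_on {U V : NormedModule C_AbsRing}
    (D : U -> Prop) (f : U -> V) : Prop :=
  open D /\ forall p : U, D p -> ex_filterdiff f (locally p).

(* Main.v *)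
Require Import Defs.
From Stdlib Require Import Reals ZArith Lra Lia Psatz FunctionalExtensionality.
From Coquelicot Require Import Coquelicot.

(** With [t_j = e^(lambda s - lambda j)] the coefficient of [q_j] is
    [1 / (1 + e^(lambda (j - s))) = t_j / (1 + t_j)], which decays like
    [e^(- j Re lambda)], locally uniformly in the parameters.  Hence from some
    rank [N] on, all the [q_j] map the disc of radius 2 into the unit disc and
    contract it.  Nested compositions of contractions converge
    geometrically, to a limit that does not depend on the innermost argument;
    and any fixed [z] is sent into the unit disc by [q_n] for [n] large.
    Composing with the finitely many continuous maps [q_1 .. q_N] gives the
    convergence for every [z] ([beta_tends]).

    The functional equation is the identity [q_(j+1) (s + 1) = q_j s]: the
    compositions at [s + 1] are those at [s] with one more map applied outside
    ([beta_succ]).  Read backwards it says that the tail of the compositions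
    starting at rank [N + 1] converges to [beta (s - N)].

    For the holomorphy one must differentiate a limit of functions of several
    complex variables.  Instead of Cauchy estimates the proof exploits the
    recursion [b_j = Q_j (., b_(j+1))] satisfied by [b_j = beta (s - N - j)],
    where [Q_j (p, w)] is [q_(N+j+1)].  The maps [Q_j] have quadratic Taylor
    remainders with a constant independent of [j] ([equidiff]), and their
    partial derivatives in [w] are at most [1/2].  The linearised recursion
    [L_j = A_j + B_j L_(j+1)] therefore has a bounded solution, and the errors
    [b_j (p + h) - b_j p - L_j h] satisfy the same contracting recursion with
    a source of size [|h|^2].  A bounded sequence with
    [x_j <= c + x_(j+1) / 2] is at most [2 c] ([backward_bound]), so these
    errors are [O(|h|^2)] ([equidiff_recursion]).  Finally [beta] is obtained
    from [b_0] by the finitely many maps [q_1 .. q_N], which are holomorphic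
    where their denominators do not vanish, that is on [LL]. *)

Local Open Scope R_scope.
Local Arguments Cmod x%_C_scope.
Local Arguments Cexp w%_C_scope.

(** * The complex exponential *)

Lemma Cexp_plus (u v : C) : Cexp (u + v) = (Cexp u * Cexp v)%C.
Proof.
  destruct u as [a b], v as [c d]; unfold Cexp, Cplus, Cmult; simpl.
  rewrite exp_plus, cos_plus, sin_plus; f_equal; ring.
Qed.

Lemma Cexp_0 : Cexp 0 = 1%C.
Proof.
  unfold Cexp; simpl; rewrite exp_0, cos_0, sin_0.
  unfold RtoC; f_equal; ring.
Qed.

Lemma Cmod_Cexp (w : C) : Cmod (Cexp w) = exp (Re w).
Proof.
  destruct w as [a b]; unfold Cmod, Cexp; simpl.
  generalize (sin2_cos2 b); unfold Rsqr; intro Hb.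
  transitivity (sqrt (exp a ^ 2)); [f_equal | apply sqrt_pow2; left; apply exp_pos].
  transitivity (exp a * exp a * (sin b * sin b + cos b * cos b)); [ring|].
  rewrite Hb; ring.
Qed.

Lemma Cexp_neq_0 (w : C) : Cexp w <> 0%C.
Proof.
  apply Cmod_gt_0; rewrite Cmod_Cexp; apply exp_pos.
Qed.

Lemma Cexp_opp (w : C) : Cexp (- w) = (/ Cexp w)%C.
Proof.
  assert (H : (Cexp (- w) * Cexp w)%C = 1%C).
  { rewrite <- Cexp_plus, <- Cexp_0; f_equal; ring. }
  rewrite <- (Cmult_1_l (/ Cexp w)), <- H; field; apply Cexp_neq_0.
Qed.

Lemma Re_le_Cmod (w : C) : Re w <= Cmod w.
Proof.
  eapply Rle_trans; [apply Rle_abs | apply re_le_Cmod].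
Qed.

Lemma Cmod_Cexp_le (w : C) : Cmod (Cexp w) <= exp (Cmod w).
Proof.
  rewrite Cmod_Cexp; destruct (Re_le_Cmod w) as [H|H].
  - left; now apply exp_increasing.
  - right; now rewrite H.
Qed.

Lemma exp_le (x y : R) : x <= y -> exp x <= exp y.
Proof.
  intros [H|H]; [left; now apply exp_increasing | right; now rewrite H].
Qed.

(** Apply [1 + t <= exp t] at [- x] and multiply by [exp x]. *)
Lemma exp_m1_le (x : R) : exp x - 1 <= x * exp x.
Proof.
  generalize (exp_ineq1_le (- x)), (exp_pos x); intros H Hp.
  assert (E : exp x * exp (- x) = 1).
  { rewrite <- exp_plus, Rplus_opp_r; apply exp_0. }
  nra.
Qed.

Lemma Rabs_exp_m1 (x : R) : Rabs (exp x - 1) <= Rabs x * exp (Rabs x).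
Proof.
  generalize (exp_m1_le x), (exp_ineq1_le x); intros H1 H2.
  unfold Rabs at 2 3.
  destruct (Rcase_abs x) as [Hx|Hx].
  - assert (exp x <= 1) by (rewrite <- exp_0; apply exp_le; lra).
    assert (1 <= exp (- x)) by (rewrite <- exp_0; apply exp_le; lra).
    rewrite Rabs_left1; nra.
  - rewrite Rabs_right; lra.
Qed.

(** The remainder is squeezed between 0 and [x (exp x - 1)]. *)
Lemma Rabs_exp_m1_mx (x : R) : Rabs (exp x - 1 - x) <= Rabs x * Rabs x * exp (Rabs x).
Proof.
  generalize (exp_m1_le x), (exp_ineq1_le x), (Rabs_exp_m1 x); intros H1 H2 H3.
  rewrite Rabs_right by lra.
  apply Rle_trans with (x * (exp x - 1)); [lra|].
  eapply Rle_trans; [apply Rle_abs|].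
  rewrite Rabs_mult, Rmult_assoc.
  apply Rmult_le_compat_l; [apply Rabs_pos | exact H3].
Qed.

Lemma Rabs_sin_le (y : R) : Rabs (sin y) <= Rabs y.
Proof.
  destruct (MVT_gen sin 0 y cos) as [c [_ Hc]].
  - intros x _; apply is_derive_Reals, derivable_pt_lim_sin.
  - intros x _; apply continuity_sin.
  - rewrite sin_0, !Rminus_0_r in Hc; rewrite Hc, Rabs_mult.
    generalize (COS_bound c), (Rabs_pos y); intros Hb Hy.
    assert (Rabs (cos c) <= 1) by (apply Rabs_le; lra).
    nra.
Qed.

Lemma one_minus_cos (y : R) : 1 - cos y = 2 * (sin (y / 2) * sin (y / 2)).
Proof.
  replace y with (2 * (y / 2)) at 1 by field.
  rewrite cos_2a_sin; ring.
Qed.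

Lemma Rabs_cos_m1 (y : R) : Rabs (cos y - 1) <= Rabs y * Rabs y.
Proof.
  rewrite Rabs_minus_sym, one_minus_cos, !Rabs_mult, (Rabs_right 2) by lra.
  generalize (Rabs_sin_le (y / 2)), (Rabs_pos (sin (y / 2))), (Rabs_pos y).
  unfold Rdiv; rewrite (Rabs_mult y), (Rabs_right (/ 2)) by lra; intros; nra.
Qed.

Lemma Rabs_cos_m1_lin (y : R) : Rabs (cos y - 1) <= Rabs y.
Proof.
  rewrite Rabs_minus_sym, one_minus_cos, !Rabs_mult, (Rabs_right 2) by lra.
  generalize (Rabs_sin_le (y / 2)), (Rabs_pos (sin (y / 2))), (SIN_bound (y / 2)).
  unfold Rdiv; rewrite (Rabs_mult y), (Rabs_right (/ 2)) by lra; intros.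
  assert (Rabs (sin (y * / 2)) <= 1) by (apply Rabs_le; lra).
  nra.
Qed.

Lemma Rabs_sin_mx (y : R) : Rabs (sin y - y) <= Rabs y * Rabs y.
Proof.
  destruct (MVT_gen (fun t => sin t - t) 0 y (fun t => cos t - 1)) as [c [Hcy Hc]].
  - intros x _; auto_derive; [trivial | ring].
  - intros x _; apply derivable_continuous_pt.
    apply derivable_pt_minus; [apply derivable_pt_sin | apply derivable_pt_id].
  - rewrite sin_0 in Hc.
    replace (sin y - y) with ((cos c - 1) * y) by lra.
    rewrite Rabs_mult; apply Rmult_le_compat_r; [apply Rabs_pos|].
    apply Rle_trans with (Rabs c).
    + apply Rabs_cos_m1_lin.
    + revert Hcy; unfold Rmin, Rmax, Rabs.
      destruct (Rle_dec 0 y), (Rcase_abs c), (Rcase_abs y); intros; lra.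
Qed.

Lemma Rabs_Im_le_Cmod (w : C) : Rabs (Im w) <= Cmod w.
Proof.
  eapply Rle_trans; [apply Rmax_r | apply Rmax_Cmod].
Qed.

Lemma Cmod_le_Rabs (x y : R) : Cmod (x, y) <= Rabs x + Rabs y.
Proof.
  replace (x, y) with (RtoC x + Ci * RtoC y)%C.
  - eapply Rle_trans; [apply Cmod_triangle|].
    rewrite Cmod_mult, Cmod_Ci, !Cmod_R; lra.
  - unfold RtoC, Ci, Cplus, Cmult; simpl; f_equal; ring.
Qed.

(** Write the real and imaginary parts of the remainder in terms of
    [exp x - 1 - x], [cos y - 1] and [sin y - y], each of second order. *)
Lemma Cexp_taylor1 (d : C) : Cmod (Cexp d - 1 - d) <= 4 * Cmod d ^ 2 * exp (Cmod d).
Proof.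
  generalize (re_le_Cmod d), (Rabs_Im_le_Cmod d), (Cmod_Cexp_le d).
  rewrite Cmod_Cexp.
  destruct d as [x y]; simpl Re; simpl Im; set (m := Cmod (x, y)); intros Hx Hy Hexp.
  generalize (Rabs_exp_m1 x), (Rabs_exp_m1_mx x), (Rabs_cos_m1 y), (Rabs_sin_mx y);
    intros E1 E2 Ec Es.
  assert (Hm : exp (Rabs x) <= exp m) by now apply exp_le.
  generalize (Rabs_pos x), (Rabs_pos y), (exp_pos m), (exp_pos x), (exp_pos (Rabs x));
    intros X0 Y0 M0 EX0 EA0.
  assert (xx : Rabs x * Rabs x <= m ^ 2) by nra.
  assert (yy : Rabs y * Rabs y <= m ^ 2) by nra.
  assert (xy : Rabs x * Rabs y <= m ^ 2) by nra.
  assert (m2 : 0 <= m ^ 2) by nra.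
  replace (Cexp (x, y) - 1 - (x, y))%C with
    (exp x * (cos y - 1) + (exp x - 1 - x), exp x * (sin y - y) + (exp x - 1) * y)
    by (unfold Cexp, Cminus, Cplus, Copp, RtoC; simpl; f_equal; ring).
  eapply Rle_trans; [apply Cmod_le_Rabs|].
  assert (T1 : Rabs (exp x * (cos y - 1)) <= m ^ 2 * exp m).
  { rewrite Rabs_mult, (Rabs_right (exp x)) by lra; rewrite Rmult_comm.
    apply Rmult_le_compat; try lra; apply Rabs_pos. }
  assert (T2 : Rabs (exp x - 1 - x) <= m ^ 2 * exp m).
  { eapply Rle_trans; [apply E2|]; apply Rmult_le_compat; try lra; nra. }
  assert (T3 : Rabs (exp x * (sin y - y)) <= m ^ 2 * exp m).
  { rewrite Rabs_mult, (Rabs_right (exp x)) by lra; rewrite Rmult_comm.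
    apply Rmult_le_compat; try lra; apply Rabs_pos. }
  assert (T4 : Rabs ((exp x - 1) * y) <= m ^ 2 * exp m).
  { rewrite Rabs_mult.
    apply Rle_trans with (Rabs x * Rabs y * exp (Rabs x)); [nra|].
    apply Rmult_le_compat; try lra; nra. }
  generalize (Rabs_triang (exp x * (cos y - 1)) (exp x - 1 - x)),
    (Rabs_triang (exp x * (sin y - y)) ((exp x - 1) * y)); lra.
Qed.

Lemma Cexp_taylor0 (d : C) : Cmod (Cexp d - 1) <= 3 * Cmod d * exp (Cmod d).
Proof.
  generalize (re_le_Cmod d), (Rabs_Im_le_Cmod d), (Cmod_Cexp_le d).
  rewrite Cmod_Cexp.
  destruct d as [x y]; simpl Re; simpl Im; set (m := Cmod (x, y)); intros Hx Hy Hexp.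
  generalize (Rabs_exp_m1 x), (Rabs_cos_m1_lin y), (Rabs_sin_le y); intros E1 Ec Es.
  assert (Hm : exp (Rabs x) <= exp m) by now apply exp_le.
  generalize (Rabs_pos x), (Rabs_pos y), (exp_pos m), (exp_pos x), (exp_pos (Rabs x));
    intros X0 Y0 M0 EX0 EA0.
  replace (Cexp (x, y) - 1)%C with
    (exp x * (cos y - 1) + (exp x - 1), exp x * sin y)
    by (unfold Cexp, Cminus, Cplus, Copp, RtoC; simpl; f_equal; ring).
  eapply Rle_trans; [apply Cmod_le_Rabs|].
  assert (T1 : Rabs (exp x * (cos y - 1)) <= m * exp m).
  { rewrite Rabs_mult, (Rabs_right (exp x)) by lra; rewrite Rmult_comm.
    apply Rmult_le_compat; try lra; apply Rabs_pos. }
  assert (T2 : Rabs (exp x - 1) <= m * exp m).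
  { eapply Rle_trans; [apply E1|]; apply Rmult_le_compat; try lra; nra. }
  assert (T3 : Rabs (exp x * sin y) <= m * exp m).
  { rewrite Rabs_mult, (Rabs_right (exp x)) by lra; rewrite Rmult_comm.
    apply Rmult_le_compat; try lra; apply Rabs_pos. }
  generalize (Rabs_triang (exp x * (cos y - 1)) (exp x - 1)); lra.
Qed.

(** From [e^u - e^v = e^v (e^(u - v) - 1)]. *)
Lemma Cexp_lipschitz (M : R) (u v : C) :
  Cmod u <= M -> Cmod v <= M ->
  Cmod (Cexp u - Cexp v) <= 3 * exp (3 * M) * Cmod (u - v).
Proof.
  intros Hu Hv.
  replace (Cexp u - Cexp v)%C with (Cexp v * (Cexp (u - v) - 1))%C.
  2: { replace (Cexp u) with (Cexp (v + (u - v))) by (f_equal; ring).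
       rewrite Cexp_plus; ring. }
  rewrite Cmod_mult.
  assert (Huv : Cmod (u - v) <= 2 * M).
  { generalize (Cmod_triangle u (- v)); rewrite Cmod_opp; unfold Cminus; lra. }
  generalize (Cexp_taylor0 (u - v)), (Cmod_Cexp_le v), (exp_le _ _ Hv), (exp_le _ _ Huv),
    (Cmod_ge_0 (u - v)), (Cmod_ge_0 (Cexp v)), (Cmod_ge_0 (Cexp (u - v) - 1)).
  intros T1 T2 T3 T4 P1 P2 P3.
  replace (3 * M) with (M + 2 * M) by ring; rewrite exp_plus.
  generalize (exp_pos M); intro EM.
  apply Rle_trans with (exp M * (3 * Cmod (u - v) * exp (2 * M))); [|right; ring].
  apply Rmult_le_compat; try lra.
  eapply Rle_trans; [apply T1|].
  apply Rmult_le_compat_l; lra.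
Qed.

Lemma Cexp_pole (k : Z) : Cexp (RtoC (IZR (2 * k + 1)) * RtoC PI * Ci) = (- (1))%C.
Proof.
  rewrite plus_IZR, mult_IZR; unfold Cexp, Cmult, RtoC, Ci, Copp; simpl Re; simpl Im; simpl fst; simpl snd.
  replace (((2 * IZR k + 1) * PI - 0 * 0) * 0 - ((2 * IZR k + 1) * 0 + 0 * PI) * 1)
    with 0 by ring.
  replace (((2 * IZR k + 1) * PI - 0 * 0) * 1 + ((2 * IZR k + 1) * 0 + 0 * PI) * 0)
    with (2 * IZR k * PI + PI) by ring.
  assert (S : sin (2 * IZR k * PI) = 0).
  { apply sin_eq_0_1; exists (2 * k)%Z; rewrite mult_IZR; ring. }
  assert (Cc : cos (2 * IZR k * PI) = 1).
  { replace (2 * IZR k * PI) with (2 * (IZR k * PI)) by ring.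
    rewrite cos_2a_sin, (sin_eq_0_1 (IZR k * PI)); [ring | now exists k]. }
    rewrite neg_sin, neg_cos, S, Cc, exp_0; f_equal; ring.
Qed.

(** From [exp x * sin y = 0] the angle is [k * PI], and an even [k] would make
    the real part positive. *)
Lemma Cexp_eq_m1 (w : C) :
  Cexp w = (- (1))%C ->
  exists k : Z, w = (RtoC (IZR (2 * k + 1)) * RtoC PI * Ci)%C.
Proof.
  intro H.
  assert (Hx : Re w = 0).
  { apply exp_inv; rewrite <- Cmod_Cexp, H, Cmod_opp, Cmod_1, exp_0; reflexivity. }
  destruct w as [x y]; simpl in Hx; subst x.
  unfold Cexp, Copp, RtoC in H; simpl in H; rewrite exp_0 in H.
  injection H as Hc Hs.
  destruct (sin_eq_0_0 y) as [n Hn]; [lra|].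
  destruct (Z.Even_or_Odd n) as [[k Hk]|[k Hk]].
  - exfalso; subst n.
    assert (Cc : cos y = 1).
    { rewrite Hn, mult_IZR.
      replace (2 * IZR k * PI) with (2 * (IZR k * PI)) by ring.
      rewrite cos_2a_sin, (sin_eq_0_1 (IZR k * PI)); [ring | now exists k]. }
    lra.
  - exists k; subst n y; unfold RtoC, Ci, Cmult; simpl; f_equal; ring.
Qed.

(** * Limits of nested contractions *)

Definition Ctends (u : nat -> C) (l : C) : Prop :=
  forall eps, 0 < eps -> exists N, forall n, (N <= n)%nat -> Cmod (u n - l) < eps.

Lemma filterlim_Ctends (u : nat -> C) (l : C) :
  filterlim u eventually (locally l) <-> Ctends u l.
Proof.
  split.
  - intros H eps He.
    exact (proj1 (filterlim_locally_ball_norm (U := C_NormedModule) u l) H (mkposreal eps He)).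
  - intros H.
    apply (proj2 (filterlim_locally_ball_norm (U := C_NormedModule) u l)).
    intros eps; exact (H eps (cond_pos eps)).
Qed.

Lemma Ctends_unique (u : nat -> C) (l l' : C) : Ctends u l -> Ctends u l' -> l = l'.
Proof.
  intros H H'.
  apply (filterlim_locally_unique (V := C_NormedModule) (F := eventually) u);
    now apply filterlim_Ctends.
Qed.

Lemma Ctends_shift (k : nat) (u : nat -> C) (l : C) :
  Ctends (fun n => u (k + n)%nat) l -> Ctends u l.
Proof.
  intros H eps He; destruct (H eps He) as [N HN].
  exists (k + N)%nat; intros n Hn.
  replace n with (k + (n - k))%nat by lia; apply HN; lia.
Qed.

Lemma Ctends_bound (M : R) (u : nat -> C) (l : C) :
  (forall n, Cmod (u n) <= M) -> Ctends u l -> Cmod l <= M.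
Proof.
  intros Hu H; apply le_epsilon; intros eps He.
  destruct (H eps He) as [N HN].
  specialize (HN N (Nat.le_refl N)); specialize (Hu N).
  generalize (Cmod_triangle (u N) (- (u N - l))); rewrite Cmod_opp.
  replace (u N + - (u N - l))%C with l by ring; lra.
Qed.

Lemma Ctends_lipschitz (f : C -> C) (K r : R) (u : nat -> C) (l : C) :
  0 < r ->
  (forall w, Cmod (w - l) < r -> Cmod (f w - f l) <= K * Cmod (w - l)) ->
  Ctends u l -> Ctends (fun n => f (u n)) (f l).
Proof.
  intros Hr Hf Hu eps He.
  assert (HK : 0 < Rabs K + 1) by (generalize (Rabs_pos K); lra).
  destruct (Hu (Rmin r (eps / (Rabs K + 1)))) as [N HN].
  { apply Rmin_pos; [lra | now apply Rdiv_lt_0_compat]. }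
  exists N; intros n Hn; specialize (HN n Hn).
  generalize (Rmin_l r (eps / (Rabs K + 1))), (Rmin_r r (eps / (Rabs K + 1))); intros R1 R2.
  eapply Rle_lt_trans; [apply Hf; lra|].
  generalize (Cmod_ge_0 (u n - l)), (Rle_abs K); intros P1 P2.
  assert (Q : Cmod (u n - l) < eps / (Rabs K + 1)) by lra.
  apply (Rmult_lt_compat_r (Rabs K + 1)) in Q; [|lra].
  unfold Rdiv in Q; rewrite Rmult_assoc, Rinv_l, Rmult_1_r in Q by lra.
  nra.
Qed.

Fixpoint nest (T : nat -> C -> C) (n : nat) (z : C) : C :=
  match n with
  | O => z
  | S m => nest T m (T m z)
  end.

Lemma nest_add (T : nat -> C -> C) (k n : nat) (z : C) :
  nest T (k + n) z = nest T k (nest (fun i => T (k + i)%nat) n z).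
Proof.
  revert z; induction n as [|n IH]; intro z.
  - now rewrite Nat.add_0_r.
  - rewrite Nat.add_succ_r; simpl; apply IH.
Qed.

Definition contracting (M : R) (T : nat -> C -> C) : Prop :=
  (forall i w, Cmod w <= M -> Cmod (T i w) <= M) /\
  (forall i w w', Cmod w <= M -> Cmod w' <= M ->
     Cmod (T i w - T i w') <= / 2 * Cmod (w - w')).

Lemma contracting_shift (M : R) (T : nat -> C -> C) (k : nat) :
  contracting M T -> contracting M (fun i => T (k + i)%nat).
Proof.
  intros [H1 H2]; split; intros; [now apply H1 | now apply H2].
Qed.

Lemma nest_bound (M : R) (T : nat -> C -> C) (n : nat) (z : C) :
  contracting M T -> Cmod z <= M -> Cmod (nest T n z) <= M.
Proof.
  intros [H _]; revert z; induction n as [|n IH]; intros z Hz; simpl; auto.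
Qed.

Lemma nest_contracts (M : R) (T : nat -> C -> C) (n : nat) (z z' : C) :
  contracting M T -> Cmod z <= M -> Cmod z' <= M ->
  Cmod (nest T n z - nest T n z') <= (/ 2) ^ n * Cmod (z - z').
Proof.
  intros [H1 H2]; revert z z'; induction n as [|n IH]; intros z z' Hz Hz'; simpl.
  - lra.
  - eapply Rle_trans; [apply IH; auto|].
    replace (/ 2 * (/ 2) ^ n * Cmod (z - z')) with ((/ 2) ^ n * (/ 2 * Cmod (z - z'))) by ring.
    apply Rmult_le_compat_l; [apply pow_le; lra | auto].
Qed.

Lemma pow_half_small (K eps : R) :
  0 < eps -> exists N, forall n, (N <= n)%nat -> (/ 2) ^ n * K < eps.
Proof.
  intro He.
  assert (HK : 0 < Rabs K + 1) by (generalize (Rabs_pos K); lra).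
  destruct (pow_lt_1_zero (/ 2)) with (y := eps / (Rabs K + 1)) as [N HN].
  - rewrite Rabs_right; lra.
  - now apply Rdiv_lt_0_compat.
  - exists N; intros n Hn; specialize (HN n Hn).
    assert (P : 0 < (/ 2) ^ n) by (apply pow_lt; lra).
    rewrite Rabs_right in HN by lra.
    apply (Rmult_lt_compat_r (Rabs K + 1)) in HN; [|lra].
    unfold Rdiv in HN; rewrite Rmult_assoc, Rinv_l, Rmult_1_r in HN by lra.
    generalize (Rle_abs K); nra.
Qed.

Lemma Cmod_minus_le (x y : C) : Cmod (x - y) <= Cmod x + Cmod y.
Proof.
  rewrite <- (Cmod_opp y); apply Cmod_triangle.
Qed.

(** All compositions of length at least [N] are values of the same
    [nest T N] on the disc, and that map shrinks distances by [2^N]. *)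
Lemma contracting_cauchy (M : R) (T : nat -> C -> C) :
  0 <= M -> contracting M T ->
  exists l : C, Ctends (fun n => nest T n 0) l.
Proof.
  intros HM HT.
  destruct (proj1 (filterlim_locally_cauchy (U := C_CompleteNormedModule) (F := eventually)
             (fun n => nest T n 0))) as [l Hl].
  2: { exists l; now apply filterlim_Ctends. }
  intros eps.
  destruct (pow_half_small (2 * M) eps (cond_pos eps)) as [N HN].
  exists (fun n => (N <= n)%nat); split; [now exists N|].
  intros u v Hu Hv.
  apply C_NormedModule_mixin_compat1.
  apply Rle_lt_trans with ((/ 2) ^ N * (2 * M)); [|now apply HN].
  assert (B : forall k, Cmod (nest (fun i => T (N + i)%nat) k 0) <= M).
  { intro k; apply nest_bound; [now apply contracting_shift | now rewrite Cmod_0]. }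
  replace u with (N + (u - N))%nat by lia; replace v with (N + (v - N))%nat by lia.
  rewrite !nest_add.
  eapply Rle_trans; [eapply nest_contracts; eauto|].
  apply Rmult_le_compat_l; [apply pow_le; lra|].
  eapply Rle_trans; [apply Cmod_minus_le|].
  generalize (B (u - N)%nat), (B (v - N)%nat); lra.
Qed.

Definition nest_lim (T : nat -> C -> C) : C :=
  @iota C_CompleteNormedModule
    (fun l : C => filterlim (fun n => nest T n 0) eventually (locally l)).

Section NestLim.

Context (M : R) (T : nat -> C -> C) (HM : 0 <= M) (HT : contracting M T).

Lemma nest_lim_0 : Ctends (fun n => nest T n 0) (nest_lim T).
Proof.
  destruct (contracting_cauchy M T HM HT) as [l Hl].
  apply filterlim_Ctends in Hl.
  assert (E : nest_lim T = l).
  { exact (iota_filterlim_locally (V := C_CompleteNormedModule) (F := eventually)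
             (fun n => nest T n 0) l Hl). }
  rewrite E.
  now apply filterlim_Ctends.
Qed.

Lemma nest_lim_bound : Cmod (nest_lim T) <= M.
Proof.
  apply Ctends_bound with (2 := nest_lim_0); intro n.
  apply nest_bound; [assumption | now rewrite Cmod_0].
Qed.

(** The innermost argument may vary with [n]: only its being eventually in
    the disc matters. *)
Lemma nest_lim_moving (z : nat -> C) (k : nat) :
  (forall n, (k <= n)%nat -> Cmod (z n) <= M) ->
  Ctends (fun n => nest T n (z n)) (nest_lim T).
Proof.
  intros Hz eps He.
  destruct (nest_lim_0 (eps / 2)) as [N1 H1]; [lra|].
  destruct (pow_half_small M (eps / 2)) as [N2 H2]; [lra|].
  exists (max k (max N1 N2)); intros n Hn.
  specialize (H1 n ltac:(lia)); specialize (H2 n ltac:(lia)).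
  assert (H3 : Cmod (nest T n (z n) - nest T n 0) <= (/ 2) ^ n * M).
  { eapply Rle_trans; [apply (nest_contracts M); auto|].
    - apply Hz; lia.
    - now rewrite Cmod_0.
    - apply Rmult_le_compat_l; [apply pow_le; lra|].
      replace (z n - 0)%C with (z n) by ring; apply Hz; lia. }
  replace (nest T n (z n) - nest_lim T)%C
    with ((nest T n (z n) - nest T n 0) + (nest T n 0 - nest_lim T))%C by ring.
  eapply Rle_lt_trans; [apply Cmod_triangle | lra].
Qed.

End NestLim.

(** Peel off the outermost map, which is continuous on the disc. *)
Lemma nest_lim_unfold (M : R) (T : nat -> C -> C) :
  0 <= M -> contracting M T ->
  nest_lim T = T O (nest_lim (fun i => T (S i))).
Proof.
  intros HM HT.
  assert (HS : contracting M (fun i => T (S i))) by exact (contracting_shift M T 1 HT).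
  apply Ctends_unique with (fun n => nest T n 0).
  - now apply nest_lim_0 with M.
  - apply (Ctends_shift 1).
    intros eps He.
    destruct (nest_lim_0 M _ HM HS eps He) as [N HN].
    exists N; intros n Hn.
    rewrite nest_add; simpl nest at 1.
    eapply Rle_lt_trans; [apply (proj2 HT)|].
    + apply nest_bound; [exact HS | now rewrite Cmod_0].
    + now apply nest_lim_bound.
    + specialize (HN n Hn).
      generalize (Cmod_ge_0 (nest (fun i => T (S i)) n 0 - nest_lim (fun i => T (S i)))).
      simpl; lra.
Qed.

(** * Convergence of the nested compositions *)

(** The quantity [e^(- lambda (j - s))], the inverse of the exponential in the
    denominator of [q_j]; unlike the latter it tends to 0. *)
Definition weight (s lambda : C) (j : nat) : C := Cexp (lambda * s - RtoC (INR j) * lambda).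

(** Near [lambda0] the real part of [lambda] stays above [Re lambda0 / 2] and
    [lambda s] stays bounded, so the decay in [j] is uniform. *)
Lemma weight_small (s0 lambda0 : C) (eps : R) :
  0 < Re lambda0 -> 0 < eps ->
  exists (N : nat) (d : R), 0 < d /\
    forall s lambda, Cmod (s - s0) < d -> Cmod (lambda - lambda0) < d ->
    0 < Re lambda /\ forall j, (N <= j)%nat -> Cmod (weight s lambda j) <= eps.
Proof.
  intros Hl He.
  set (c := Re lambda0 / 2).
  set (K := (Cmod lambda0 + 1) * (Cmod s0 + 1)).
  assert (Hc : 0 < c) by (unfold c; lra).
  destruct (nfloor_ex (Rmax 0 ((K - ln eps) / c))) as [N0 [_ HN0]]; [apply Rmax_l|].
  exists (S N0), (Rmin 1 c); split; [apply Rmin_pos; lra|].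
  intros s lambda Hs Hlam.
  generalize (Rmin_l 1 c), (Rmin_r 1 c); intros R1 R2.
  assert (Hre : c <= Re lambda).
  { generalize (re_le_Cmod (lambda - lambda0)).
    replace (Re (lambda - lambda0)) with (Re lambda - Re lambda0)
      by (destruct lambda, lambda0; simpl; ring).
    intro H; generalize (Rabs_maj2 (Re lambda - Re lambda0)); unfold c in *; lra. }
  split; [lra|]; intros j Hj.
  unfold weight; rewrite Cmod_Cexp, <- (exp_ln eps He); apply exp_le.
  replace (Re (lambda * s - RtoC (INR j) * lambda)) with (Re (lambda * s) - INR j * Re lambda)
    by (destruct lambda, s; simpl; ring).
  assert (HK : Re (lambda * s) <= K).
  { eapply Rle_trans; [apply Re_le_Cmod|]; rewrite Cmod_mult.
    assert (A : forall u v, Cmod (u - v) < 1 -> Cmod u <= Cmod v + 1).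
    { intros u v H; generalize (Cmod_triangle (u - v) v).
      replace (u - v + v)%C with u by ring; lra. }
    apply Rmult_le_compat; try apply Cmod_ge_0; apply A; lra. }
  assert (Hjr : (K - ln eps) / c <= INR j).
  { generalize (Rmax_r 0 ((K - ln eps) / c)), (le_INR _ _ Hj); rewrite S_INR; lra. }
  apply (Rmult_le_compat_r c) in Hjr; [|lra].
  unfold Rdiv in Hjr; rewrite Rmult_assoc, Rinv_l, Rmult_1_r in Hjr by lra.
  assert (INR j * c <= INR j * Re lambda) by (apply Rmult_le_compat_l; [apply pos_INR | lra]).
  lra.
Qed.

Lemma Cexp_denominator (s lambda : C) (j : nat) :
  Cexp (lambda * (RtoC (INR j) - s)) = (/ weight s lambda j)%C.
Proof.
  unfold weight; rewrite <- Cexp_opp; f_equal; ring.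
Qed.

Lemma one_plus_neq_0 (t : C) : Cmod t <= / 2 -> (1 + t)%C <> 0%C.
Proof.
  intros Ht H.
  assert (E : t = (- (1))%C) by (replace t with (1 + t - 1)%C by ring; rewrite H; ring).
  rewrite E, Cmod_opp, Cmod_1 in Ht; lra.
Qed.

Lemma inv_denominator (s lambda : C) (j : nat) :
  (1 + weight s lambda j)%C <> 0%C ->
  (/ (1 + Cexp (lambda * (RtoC (INR j) - s))) = weight s lambda j * / (1 + weight s lambda j))%C.
Proof.
  intro H; rewrite Cexp_denominator.
  assert (Hw : weight s lambda j <> 0%C) by apply Cexp_neq_0.
  field; repeat split; try assumption; rewrite Cplus_comm; assumption.
Qed.

Lemma denominator_neq_0 (s lambda : C) (j : nat) :
  Cmod (weight s lambda j) <= / 2 -> (1 + Cexp (lambda * (RtoC (INR j) - s)))%C <> 0%C.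
Proof.
  intros H H0; rewrite Cexp_denominator in H0.
  apply (one_plus_neq_0 _ H).
  assert (Hw : weight s lambda j <> 0%C) by apply Cexp_neq_0.
  replace (1 + weight s lambda j)%C
    with (weight s lambda j * (1 + / weight s lambda j))%C by (field; exact Hw).
  rewrite H0; ring.
Qed.

Lemma Cmod_inv_denominator (s lambda : C) (j : nat) :
  Cmod (weight s lambda j) <= / 2 ->
  Cmod (/ (1 + Cexp (lambda * (RtoC (INR j) - s)))) <= 2 * Cmod (weight s lambda j).
Proof.
  intro H.
  assert (H1 : (1 + weight s lambda j)%C <> 0%C) by now apply one_plus_neq_0.
  rewrite inv_denominator, Cmod_mult, Cmod_inv by exact H1.
  assert (H2 : / 2 <= Cmod (1 + weight s lambda j)).
  { generalize (Cmod_minus_le (1 + weight s lambda j) (weight s lambda j)).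
    replace (1 + weight s lambda j - weight s lambda j)%C with (RtoC 1) by ring.
    rewrite Cmod_1; lra. }
  rewrite Rmult_comm; apply Rmult_le_compat_r; [apply Cmod_ge_0|].
  rewrite <- (Rinv_inv 2).
  apply Rinv_le_contravar; lra.
Qed.

Lemma q_factor (lambda mu s z : C) (j : nat) :
  q lambda mu j s z = (/ (1 + Cexp (lambda * (RtoC (INR j) - s))) * Cexp (mu * z))%C.
Proof.
  unfold q, Cdiv; ring.
Qed.

Lemma q_lipschitz (lambda mu s : C) (j : nat) (r : R) (w w' : C) :
  Cmod w <= r -> Cmod w' <= r ->
  Cmod (q lambda mu j s w - q lambda mu j s w')
  <= Cmod (/ (1 + Cexp (lambda * (RtoC (INR j) - s))))
     * (3 * exp (3 * (Cmod mu * r)) * Cmod mu) * Cmod (w - w').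
Proof.
  intros Hw Hw'.
  rewrite !q_factor; set (a := (/ _)%C).
  replace (a * Cexp (mu * w) - a * Cexp (mu * w'))%C
    with (a * (Cexp (mu * w) - Cexp (mu * w')))%C by ring.
  rewrite Cmod_mult, !Rmult_assoc; apply Rmult_le_compat_l; [apply Cmod_ge_0|].
  generalize (Cexp_lipschitz (Cmod mu * r) (mu * w) (mu * w')); rewrite !Cmod_mult.
  replace (mu * w - mu * w')%C with (mu * (w - w'))%C by ring; rewrite Cmod_mult.
  intro H; rewrite <- Rmult_assoc; apply H; apply Rmult_le_compat_l; auto; apply Cmod_ge_0.
Qed.

Lemma q_continuous (lambda mu s : C) (j : nat) (u : nat -> C) (l : C) :
  Ctends u l -> Ctends (fun n => q lambda mu j s (u n)) (q lambda mu j s l).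
Proof.
  intro Hu.
  apply (Ctends_lipschitz (fun w => q lambda mu j s w)) with (r := 1)
    (K := Cmod (/ (1 + Cexp (lambda * (RtoC (INR j) - s))))
          * (3 * exp (3 * (Cmod mu * (Cmod l + 1))) * Cmod mu)); [lra | | exact Hu].
  intros w Hw; apply q_lipschitz; [|lra].
  generalize (Cmod_triangle (w - l) l); replace (w - l + l)%C with w by ring; lra.
Qed.

(** When [|mu| <= m], a weight below this threshold makes [q_j] map the disc of
    radius 2 into the unit disc with Lipschitz constant 1/4.  The constants are
    those of [Cexp_lipschitz] on the disc of radius [2 m]. *)
Definition threshold (m : R) : R := / (24 * (1 + m) * exp (6 * m)).

Lemma threshold_pos (m : R) : 0 <= m -> 0 < threshold m.
Proof.
  intro H; apply Rinv_0_lt_compat.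
  apply Rmult_lt_0_compat; [lra | apply exp_pos].
Qed.

Lemma threshold_half (m : R) : 0 <= m -> threshold m <= / 2.
Proof.
  intro H; apply Rinv_le_contravar; [lra|].
  assert (1 <= exp (6 * m)) by (rewrite <- exp_0; apply exp_le; lra).
  nra.
Qed.

Lemma threshold_decr (m m' : R) : 0 <= m -> m <= m' -> threshold m' <= threshold m.
Proof.
  intros H Hm.
  assert (0 < exp (6 * m)) by apply exp_pos.
  assert (exp (6 * m) <= exp (6 * m')) by (apply exp_le; lra).
  apply Rinv_le_contravar; [nra|].
  apply Rmult_le_compat; lra.
Qed.

Lemma threshold_le (m : R) (x : R) :
  0 <= m -> x <= threshold m -> 24 * (1 + m) * exp (6 * m) * x <= 1.
Proof.
  intros H Hx.
  assert (P : 0 < 24 * (1 + m) * exp (6 * m))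
    by (apply Rmult_lt_0_compat; [lra | apply exp_pos]).
  apply (Rmult_le_compat_l (24 * (1 + m) * exp (6 * m))) in Hx; [|lra].
  unfold threshold in Hx; rewrite Rinv_r in Hx; lra.
Qed.

Section SmallWeight.

Context (lambda mu s : C) (j : nat) (m : R).
Hypothesis Hmu : Cmod mu <= m.
Hypothesis Hw : Cmod (weight s lambda j) <= threshold m.

Let m_ge_0 : 0 <= m.
Proof. generalize (Cmod_ge_0 mu); lra. Qed.

Let inv_bound :
  Cmod (/ (1 + Cexp (lambda * (RtoC (INR j) - s)))) <= 2 * Cmod (weight s lambda j).
Proof. apply Cmod_inv_denominator; generalize (threshold_half m m_ge_0); lra. Qed.

Lemma q_small_bound (w : C) : Cmod w <= 2 -> Cmod (q lambda mu j s w) <= 1.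
Proof.
  intro H; rewrite q_factor, Cmod_mult.
  generalize (threshold_le m _ m_ge_0 Hw), (Cmod_ge_0 (weight s lambda j)); intros T P.
  apply Rle_trans with (2 * Cmod (weight s lambda j) * exp (6 * m)).
  - apply Rmult_le_compat; try apply Cmod_ge_0; [exact inv_bound|].
    eapply Rle_trans; [apply Cmod_Cexp_le|]; apply exp_le; rewrite Cmod_mult.
    generalize (Cmod_ge_0 w), (Cmod_ge_0 mu); nra.
  - generalize (exp_pos (6 * m)); intro E.
    assert (0 <= exp (6 * m) * Cmod (weight s lambda j)) by nra.
    assert (0 <= m * (exp (6 * m) * Cmod (weight s lambda j))) by now apply Rmult_le_pos.
    lra.
Qed.

Lemma q_small_lipschitz (w w' : C) :
  Cmod w <= 2 -> Cmod w' <= 2 ->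
  Cmod (q lambda mu j s w - q lambda mu j s w') <= / 4 * Cmod (w - w').
Proof.
  intros H H'.
  eapply Rle_trans; [apply (q_lipschitz _ _ _ _ 2); assumption|].
  apply Rmult_le_compat_r; [apply Cmod_ge_0|].
  generalize (threshold_le m _ m_ge_0 Hw), (Cmod_ge_0 (weight s lambda j)); intros T P.
  assert (E : exp (3 * (Cmod mu * 2)) <= exp (6 * m)) by (apply exp_le; lra).
  generalize (exp_pos (6 * m)), (exp_pos (3 * (Cmod mu * 2))), (Cmod_ge_0 mu); intros E0 E1 M0.
  apply Rle_trans with (2 * Cmod (weight s lambda j) * (3 * exp (6 * m) * m)).
  - apply Rmult_le_compat; [apply Cmod_ge_0 | nra | exact inv_bound |].
    apply Rmult_le_compat; lra.
  - assert (0 <= exp (6 * m) * Cmod (weight s lambda j)) by nra.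
    lra.
Qed.

End SmallWeight.

Definition q_seq (lambda mu s : C) (i : nat) : C -> C := q lambda mu (S i) s.

Lemma nested_q_nest (lambda mu s : C) (n : nat) (z : C) :
  nested_q lambda mu n s z = nest (q_seq lambda mu s) n z.
Proof.
  revert z; induction n as [|n IH]; intro z; simpl; [reflexivity | apply IH].
Qed.

Lemma small_contracting (lambda mu s : C) (N : nat) :
  (forall j, (N < j)%nat -> Cmod (weight s lambda j) <= threshold (Cmod mu)) ->
  contracting 1 (fun i => q_seq lambda mu s (N + i)).
Proof.
  intro H; split.
  - intros i w Hw; apply (q_small_bound _ _ _ _ (Cmod mu)); [lra | apply H; lia | lra].
  - intros i w w' Hw Hw'.
    eapply Rle_trans.
    + apply (q_small_lipschitz _ _ _ _ (Cmod mu)); [lra | apply H; lia | lra | lra].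
    + generalize (Cmod_ge_0 (w - w')); lra.
Qed.

Lemma weight_small_at (s lambda : C) (eps : R) :
  0 < Re lambda -> 0 < eps ->
  exists N, forall j, (N <= j)%nat -> Cmod (weight s lambda j) <= eps.
Proof.
  intros Hl He; destruct (weight_small s lambda eps Hl He) as [N [d [Hd H]]].
  exists N; apply H; unfold Cminus; rewrite Cplus_opp_r, Cmod_0; exact Hd.
Qed.

(** Far out, [q_n] sends any fixed [z] into the unit disc, where the remaining
    maps contract; hence the same limit for every [z]. *)
Lemma nested_q_tends (lambda mu s : C) :
  0 < Re lambda -> exists l : C, forall z, Ctends (fun n => nested_q lambda mu n s z) l.
Proof.
  intro Hl.
  destruct (weight_small_at s lambda (threshold (Cmod mu)) Hl) as [N HN].
  { apply threshold_pos, Cmod_ge_0. }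
  set (T := fun i => q_seq lambda mu s (N + i)).
  assert (HT : contracting 1 T) by (apply small_contracting; intros j Hj; apply HN; lia).
  exists (nest (q_seq lambda mu s) N (nest_lim T)); intro z.
  assert (Hz : Ctends (fun n => nest T n z) (nest_lim T)).
  { apply (Ctends_shift 1).
    assert (E : exp (Cmod (mu * z)) > 0) by apply exp_pos.
    destruct (weight_small_at s lambda (/ 2 * / (1 + exp (Cmod (mu * z)))) Hl) as [k Hk].
    { apply Rmult_lt_0_compat; [lra | apply Rinv_0_lt_compat; lra]. }
    assert (I : / (1 + exp (Cmod (mu * z))) * (1 + exp (Cmod (mu * z))) = 1)
      by (apply Rinv_l; lra).
    assert (I0 : 0 < / (1 + exp (Cmod (mu * z)))) by (apply Rinv_0_lt_compat; lra).
    intros eps He.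
    destruct (nest_lim_moving 1 T ltac:(lra) HT (fun n => T n z) k) with (eps := eps)
      as [n0 Hn0]; [|exact He|].
    - intros n Hn; unfold T, q_seq; rewrite q_factor, Cmod_mult.
      specialize (Hk (S (N + n)) ltac:(lia)).
      assert (Hk2 : Cmod (weight s lambda (S (N + n))) <= / 2) by nra.
      generalize (Cmod_inv_denominator s lambda _ Hk2), (Cmod_Cexp_le (mu * z)),
        (Cmod_ge_0 (Cexp (mu * z))),
        (Cmod_ge_0 (/ (1 + Cexp (lambda * (RtoC (INR (S (N + n))) - s))))).
      intros; apply Rle_trans with
        (2 * Cmod (weight s lambda (S (N + n))) * exp (Cmod (mu * z))); [|nra].
      apply Rmult_le_compat; auto.
    - now exists n0. }
  apply (Ctends_shift N).
  intros eps He.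
  assert (Hc : forall k u l, Ctends u l ->
    Ctends (fun n => nest (q_seq lambda mu s) k (u n)) (nest (q_seq lambda mu s) k l)).
  { intro k; induction k as [|k IH]; intros u l Hu; simpl; [exact Hu|].
    apply (IH (fun n => q_seq lambda mu s k (u n))); now apply q_continuous. }
  destruct (Hc N _ _ Hz eps He) as [n0 Hn0].
  exists n0; intros n Hn; rewrite nested_q_nest, nest_add; now apply Hn0.
Qed.

Lemma beta_tends (lambda mu s z : C) :
  0 < Re lambda -> Ctends (fun n => nested_q lambda mu n s z) (beta lambda mu s).
Proof.
  intro Hl; destruct (nested_q_tends lambda mu s Hl) as [l H].
  apply filterlim_Ctends; revert z; unfold beta.
  apply (iota_correct (V := C_CompleteNormedModule) (fun l : C => forall z : C,
    filterlim (fun n : nat => nested_q lambda mu n s z) eventually (locally l))).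
  exists l; split.
  - intro z; now apply filterlim_Ctends.
  - intros l' Hl'; apply Ctends_unique with (fun n => nested_q lambda mu n s 0).
    + apply H.
    + apply filterlim_Ctends, Hl'.
Qed.

Lemma q_succ (lambda mu s z : C) (j : nat) :
  q lambda mu (S j) (s + 1) z = q lambda mu j s z.
Proof.
  unfold q.
  replace (lambda * (RtoC (INR (S j)) - (s + 1)))%C with (lambda * (RtoC (INR j) - s))%C
    by (rewrite S_INR, RtoC_plus; ring).
  reflexivity.
Qed.

Lemma beta_succ (lambda mu s : C) :
  0 < Re lambda ->
  beta lambda mu (s + 1) = (Cexp (mu * beta lambda mu s) / (1 + Cexp (- lambda * s)))%C.
Proof.
  intro Hl.
  transitivity (q lambda mu 0 s (beta lambda mu s)).
  2: { unfold q.
       replace (lambda * (RtoC (INR 0) - s))%C with (- lambda * s)%C by (simpl INR; ring).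
       reflexivity. }
  apply Ctends_unique with (fun n => nested_q lambda mu n (s + 1) 0).
  - now apply beta_tends.
  - apply (Ctends_shift 1); simpl.
    intros eps He.
    destruct (q_continuous lambda mu s 0 _ _ (beta_tends lambda mu s 0 Hl) eps He) as [n0 H].
    exists n0; intros n Hn.
    replace (nested_q lambda mu n (s + 1) (q lambda mu (S n) (s + 1) 0))
      with (q lambda mu 0 s (nested_q lambda mu n s 0)); [now apply H|].
    clear; generalize (RtoC 0) as z; induction n as [|n IH]; intro z; simpl.
    + now rewrite q_succ.
    + rewrite IH; now rewrite q_succ with (j := S n).
Qed.

Lemma beta_unfold (lambda mu s : C) :
  0 < Re lambda -> beta lambda mu s = q lambda mu 1 s (beta lambda mu (s - 1)).
Proof.
  intro Hl.
  replace s with (s - 1 + 1)%C at 1 by ring.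
  rewrite beta_succ by exact Hl; unfold q.
  replace (lambda * (RtoC (INR 1) - s))%C with (- lambda * (s - 1))%C by (simpl INR; ring).
  reflexivity.
Qed.

Lemma beta_unfold_tail (lambda mu s : C) (n : nat) :
  0 < Re lambda ->
  beta lambda mu (s - RtoC (INR n))
  = q lambda mu (S n) s (beta lambda mu (s - RtoC (INR (S n)))).
Proof.
  intro Hl; rewrite beta_unfold by exact Hl.
  replace (s - RtoC (INR (S n)))%C with (s - RtoC (INR n) - 1)%C
    by (rewrite S_INR, RtoC_plus; ring).
  unfold q.
  replace (lambda * (RtoC (INR (S n)) - s))%C
    with (lambda * (RtoC (INR 1) - (s - RtoC (INR n))))%C
    by (rewrite (S_INR n), RtoC_plus; simpl INR; ring).
  reflexivity.
Qed.

Lemma beta_nested (lambda mu s : C) (n : nat) :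
  0 < Re lambda ->
  beta lambda mu s = nested_q lambda mu n s (beta lambda mu (s - RtoC (INR n))).
Proof.
  intro Hl; induction n as [|n IH]; simpl nested_q.
  - simpl INR; f_equal; ring.
  - rewrite IH; f_equal; now apply beta_unfold_tail.
Qed.

(** At [s - N] the maps are those of rank above [N], which preserve the unit
    disc; the compositions started at 0 never leave it. *)
Lemma beta_tail_bound (lambda mu s : C) (N : nat) :
  0 < Re lambda ->
  (forall j, (N < j)%nat -> Cmod (weight s lambda j) <= threshold (Cmod mu)) ->
  Cmod (beta lambda mu (s - RtoC (INR N))) <= 1.
Proof.
  intros Hl H.
  apply Ctends_bound with (2 := beta_tends lambda mu (s - RtoC (INR N)) 0 Hl); intro n.
  rewrite nested_q_nest; apply nest_bound; [|rewrite Cmod_0; lra].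
  apply (small_contracting lambda mu (s - RtoC (INR N)) 0); intros j Hj.
  replace (weight (s - RtoC (INR N)) lambda j) with (weight s lambda (N + j)).
  - apply H; lia.
  - unfold weight; rewrite plus_INR, RtoC_plus; f_equal; ring.
Qed.

(** * Equidifferentiable families *)

(** The bound is part of the notion, so that families can share it. *)
Definition clinear {E : NormedModule C_AbsRing} (K : R) (L : E -> C) : Prop :=
  (forall x y, L (plus x y) = (L x + L y)%C) /\
  (forall (c : C) x, L (scal c x) = (c * L x)%C) /\
  (forall x, Cmod (L x) <= K * norm x).

Definition expansion {E : NormedModule C_AbsRing} (K d : R)
    (f : E -> C) (p : E) (L : E -> C) : Prop :=
  clinear K L /\ Cmod (f p) <= K /\
  forall h, norm h < d -> Cmod (f (plus p h) - f p - L h) <= K * norm h ^ 2.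

(** Differentiability at the base points [p i], uniform in the index: a common
    constant bounds the values, the derivatives and the quadratic remainders.
    The base point depends on the index because the recursion below
    linearises each map at a different value of its last argument. *)
Definition equidiff {I : Type} {E : NormedModule C_AbsRing}
    (f : I -> E -> C) (p : I -> E) : Prop :=
  exists (L : I -> E -> C) (K d : R), 1 <= K /\ 0 < d <= 1 /\
    forall i, expansion K d (f i) (p i) (L i).

Lemma clinear_minus {E : NormedModule C_AbsRing} (K : R) (L : E -> C) (x y : E) : clinear K L -> L (minus x y) = (L x - L y)%C.
Proof.
  intros [H1 [H2 _]].
  assert (Hy : L (opp y) = (- (1) * L y)%C).
  { transitivity (L (scal (opp one) y)); [now rewrite scal_opp_one | apply H2]. }
  unfold minus; rewrite H1, Hy; ring.
Qed.


Section Expansion.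

Context {E : NormedModule C_AbsRing}.
Implicit Types (f g : E -> C) (p h : E) (L : E -> C).

Lemma norm_sqr_ge_0 (h : E) : 0 <= norm h ^ 2.
Proof. apply pow2_ge_0. Qed.

Lemma clinear_le K K' L : K <= K' -> clinear K L -> clinear K' L.
Proof.
  intros HK [H1 [H2 H3]]; split; [exact H1|]; split; [exact H2|]; intro x.
  eapply Rle_trans; [apply H3|].
  apply Rmult_le_compat_r; [apply norm_ge_0 | exact HK].
Qed.

Lemma expansion_weaken K K' d d' f p L :
  K <= K' -> d' <= d -> expansion K d f p L -> expansion K' d' f p L.
Proof.
  intros HK Hd [H1 [H2 H3]]; split; [now apply clinear_le with K|]; split; [lra|].
  intros h Hh; eapply Rle_trans; [apply H3; lra|].
  apply Rmult_le_compat_r; [apply norm_sqr_ge_0 | exact HK].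
Qed.

Lemma expansion_increment K d f p L (h : E) :
  1 <= K -> d <= 1 -> expansion K d f p L -> norm h < d ->
  Cmod (f (plus p h) - f p) <= 2 * K * norm h.
Proof.
  intros HK Hd [[_ [_ H1]] [_ H3]] Hh.
  replace (f (plus p h) - f p)%C with ((f (plus p h) - f p - L h) + L h)%C by ring.
  eapply Rle_trans; [apply Cmod_triangle|].
  generalize (H1 h), (H3 h Hh), (norm_ge_0 h); intros A1 A2 A3.
  assert (norm h ^ 2 <= norm h) by nra.
  nra.
Qed.

Lemma expansion_const (c : C) p : expansion (1 + Cmod c) 1 (fun _ => c) p (fun _ => 0%C).
Proof.
  generalize (Cmod_ge_0 c); intro Hc.
  split; [|split].
  - split; [intros; ring|]; split; [intros; ring|].
    intro x; rewrite Cmod_0; generalize (norm_ge_0 x); nra.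
  - lra.
  - intros h _; replace (c - c - 0)%C with (RtoC 0) by ring.
    rewrite Cmod_0; generalize (norm_sqr_ge_0 h); nra.
Qed.

Lemma expansion_linear K L p : clinear K L -> Cmod (L p) <= K -> expansion K 1 L p L.
Proof.
  intros HL HK; split; [exact HL|]; split; [exact HK|]; intros h _.
  rewrite (proj1 HL); replace (L p + L h - L p - L h)%C with (RtoC 0) by ring.
  generalize (Cmod_ge_0 (L p)), (norm_sqr_ge_0 h); rewrite Cmod_0; nra.
Qed.

Lemma expansion_plus K d f g p L L' :
  1 <= K -> expansion K d f p L -> expansion K d g p L' ->
  expansion (2 * K) d (fun x => f x + g x)%C p (fun h => L h + L' h)%C.
Proof.
  intros HK [[A1 [A2 A3]] [A4 A5]] [[B1 [B2 B3]] [B4 B5]].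
  split; [|split].
  - split; [intros; rewrite A1, B1; ring|]; split; [intros; rewrite A2, B2; ring|].
    intro x; eapply Rle_trans; [apply Cmod_triangle|].
    generalize (A3 x), (B3 x); lra.
  - eapply Rle_trans; [apply Cmod_triangle | lra].
  - intros h Hh.
    replace (f (plus p h) + g (plus p h) - (f p + g p) - (L h + L' h))%C
      with ((f (plus p h) - f p - L h) + (g (plus p h) - g p - L' h))%C by ring.
    eapply Rle_trans; [apply Cmod_triangle|].
    generalize (A5 h Hh), (B5 h Hh); lra.
Qed.

(** Besides the two products of a value and a remainder, the remainder contains
    the product of the two increments. *)
Lemma expansion_mult K d f g p L L' :
  1 <= K -> d <= 1 -> expansion K d f p L -> expansion K d g p L' ->
  expansion (6 * (K * K)) d (fun x => f x * g x)%C p (fun h => f p * L' h + g p * L h)%C.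
Proof.
  intros HK Hd HF HG.
  generalize (fun h => expansion_increment K d f p L h HK Hd HF),
    (fun h => expansion_increment K d g p L' h HK Hd HG); intros IF IG.
  destruct HF as [[A1 [A2 A3]] [A4 A5]], HG as [[B1 [B2 B3]] [B4 B5]].
  generalize (Cmod_ge_0 (f p)), (Cmod_ge_0 (g p)); intros F0 G0.
  assert (bound : forall (a b : C) x y, Cmod a <= x -> Cmod b <= y -> Cmod (a * b) <= x * y).
  { intros a b x y Ha Hb; rewrite Cmod_mult; apply Rmult_le_compat; auto; apply Cmod_ge_0. }
  split; [|split].
  - split; [intros; rewrite A1, B1; ring|]; split; [intros; rewrite A2, B2; ring|].
    intro x; eapply Rle_trans; [apply Cmod_triangle|].
    generalize (bound _ _ _ _ A4 (B3 x)), (bound _ _ _ _ B4 (A3 x)), (norm_ge_0 x).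
    assert (0 <= K * K) by nra; intros; nra.
  - generalize (bound _ _ _ _ A4 B4); nra.
  - intros h Hh.
    replace (f (plus p h) * g (plus p h) - f p * g p - (f p * L' h + g p * L h))%C
      with (f p * (g (plus p h) - g p - L' h) + g p * (f (plus p h) - f p - L h)
            + (f (plus p h) - f p) * (g (plus p h) - g p))%C by ring.
    generalize (bound _ _ _ _ A4 (B5 h Hh)), (bound _ _ _ _ B4 (A5 h Hh)),
      (bound _ _ _ _ (IF h Hh) (IG h Hh)); intros T1 T2 T3.
    eapply Rle_trans; [apply Cmod_triangle|].
    generalize (Cmod_triangle (f p * (g (plus p h) - g p - L' h))
      (g p * (f (plus p h) - f p - L h))); lra.
Qed.

(** The remainder is that of [phi] at the increment of [f], plus the
    derivative of [phi] applied to the remainder of [f].  The radius shrinks so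
    that the increment of [f], at most [2 K |h|], stays below [d]. *)
Lemma expansion_comp K d f p L (phi Lam : C_NormedModule -> C) :
  1 <= K -> 0 < d <= 1 -> expansion K d f p L -> expansion K d phi (f p) Lam ->
  expansion (5 * (K * K * K)) (d / (2 * K)) (fun x => phi (f x)) p (fun h => Lam (L h)).
Proof.
  intros HK Hd HF [HL [B4 B5]].
  generalize (fun h => expansion_increment K d f p L h HK (proj2 Hd) HF); intros IF.
  destruct HF as [[A1 [A2 A3]] [A4 A5]].
  assert (K2 : 1 <= K * K) by nra.
  assert (K3 : K * K <= K * K * K) by nra.
  assert (Hd' : d / (2 * K) * (2 * K) = d) by (field; lra).
  split; [|split].
  - split; [intros; rewrite A1; apply (proj1 HL)|].
    split; [intros; rewrite A2; apply (proj1 (proj2 HL))|].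
    intro x; eapply Rle_trans; [apply (proj2 (proj2 HL))|].
    change (norm (L x)) with (Cmod (L x)).
    generalize (A3 x), (norm_ge_0 x); intros T P.
    apply Rle_trans with (K * (K * norm x)); [apply Rmult_le_compat_l; lra|]; nra.
  - nra.
  - intros h Hh.
    generalize (norm_ge_0 h); intro P.
    assert (P2 : norm h * (2 * K) < d) by nra.
    assert (Hhd : norm h < d) by nra.
    set (D := (f (plus p h) - f p)%C).
    assert (HD : Cmod D <= 2 * K * norm h) by now apply IF.
    assert (T1 : Cmod (phi (plus (f p) D) - phi (f p) - Lam D) <= K * Cmod D ^ 2).
    { apply B5; change (Cmod D < d); lra. }
    assert (ED : (plus (f p) D : C) = f (plus p h)).
    { change (f p + D = f (plus p h))%C; unfold D; ring. }
    rewrite ED in T1.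
    assert (T2 : Cmod (Lam D - Lam (L h)) <= K * (K * norm h ^ 2)).
    { rewrite <- (clinear_minus K Lam D (L h) HL).
      eapply Rle_trans; [apply (proj2 (proj2 HL))|].
      apply Rmult_le_compat_l; [lra|]; apply (A5 h Hhd). }
    replace (phi (f (plus p h)) - phi (f p) - Lam (L h))%C
      with ((phi (f (plus p h)) - phi (f p) - Lam D) + (Lam D - Lam (L h)))%C by ring.
    eapply Rle_trans; [apply Cmod_triangle|].
    assert (T3 : Cmod D ^ 2 <= 4 * (K * K) * norm h ^ 2).
    { generalize (Cmod_ge_0 D); intro; nra. }
    generalize (norm_sqr_ge_0 h); intro P3.
    assert (K * Cmod D ^ 2 <= K * (4 * (K * K) * norm h ^ 2)) by (apply Rmult_le_compat_l; lra).
    nra.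
Qed.

End Expansion.

Section Equidiff.

Context {I : Type} {E : NormedModule C_AbsRing}.
Implicit Types (f g : I -> E -> C) (p : I -> E).

Lemma equidiff_intro f p (L : I -> E -> C) (K d : R) :
  0 < d -> (forall i, expansion K d (f i) (p i) (L i)) -> equidiff f p.
Proof.
  intros Hd H; exists L, (Rmax 1 K), (Rmin 1 d).
  split; [apply Rmax_l|]; split; [split; [apply Rmin_pos; lra | apply Rmin_l]|].
  intro i; apply expansion_weaken with K d; [apply Rmax_r | apply Rmin_r | apply H].
Qed.

Lemma equidiff_common {E' : NormedModule C_AbsRing} f p (g : I -> E' -> C) (p' : I -> E') :
  equidiff f p -> equidiff g p' ->
  exists L L' K d, 1 <= K /\ 0 < d <= 1 /\
    forall i, expansion K d (f i) (p i) (L i) /\ expansion K d (g i) (p' i) (L' i).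
Proof.
  intros [L [K [d [HK [Hd H]]]]] [L' [K' [d' [HK' [Hd' H']]]]].
  exists L, L', (Rmax K K'), (Rmin d d').
  generalize (Rmax_l K K'), (Rmax_r K K'), (Rmin_l d d'), (Rmin_r d d'); intros.
  split; [lra|]; split; [split; [apply Rmin_pos; lra | lra]|].
  intro i; split; [apply expansion_weaken with K d | apply expansion_weaken with K' d']; auto.
Qed.

Lemma equidiff_ext_near f g p (d : R) :
  0 < d ->
  (forall i h, norm h < d -> f i (plus (p i) h) = g i (plus (p i) h)) ->
  equidiff f p -> equidiff g p.
Proof.
  intros Hd Hfg [L [K [d' [HK [Hd' H]]]]].
  apply equidiff_intro with L K (Rmin d d'); [apply Rmin_pos; lra|].
  intro i; destruct (H i) as [H1 [H2 H3]].
  assert (E0 : f i (p i) = g i (p i)).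
  { rewrite <- (plus_zero_r (p i)); apply Hfg; rewrite norm_zero; exact Hd. }
  split; [exact H1|]; split; [now rewrite <- E0|]; intros h Hh.
  generalize (Rmin_l d d'), (Rmin_r d d'); intros.
  rewrite <- E0, <- Hfg by lra; apply H3; lra.
Qed.

Lemma equidiff_const (c : C) p : equidiff (fun _ _ => c) p.
Proof.
  apply equidiff_intro with (fun _ _ => 0%C) (1 + Cmod c) 1; [lra|].
  intro i; apply expansion_const.
Qed.

Lemma equidiff_linear (L : E -> C) (K M : R) p :
  clinear K L -> (forall i, Cmod (L (p i)) <= M) -> equidiff (fun _ => L) p.
Proof.
  intros HL HM; apply equidiff_intro with (fun _ => L) (Rmax K M) 1; [lra|].
  intro i; apply expansion_linear.
  - apply clinear_le with K; [apply Rmax_l | exact HL].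
  - eapply Rle_trans; [apply HM | apply Rmax_r].
Qed.

Lemma equidiff_plus f g p :
  equidiff f p -> equidiff g p -> equidiff (fun i x => f i x + g i x)%C p.
Proof.
  intros Hf Hg.
  destruct (equidiff_common f p g p Hf Hg) as [L [L' [K [d [HK [Hd H]]]]]].
  eapply equidiff_intro; [apply Hd|].
  intro i; destruct (H i); eapply (expansion_plus K); eassumption.
Qed.

Lemma equidiff_mult f g p :
  equidiff f p -> equidiff g p -> equidiff (fun i x => f i x * g i x)%C p.
Proof.
  intros Hf Hg.
  destruct (equidiff_common f p g p Hf Hg) as [L [L' [K [d [HK [Hd H]]]]]].
  eapply equidiff_intro; [apply Hd|].
  intro i; destruct (H i); eapply (expansion_mult K); eauto; lra.
Qed.

Lemma equidiff_comp f p (phi : I -> C_NormedModule -> C) :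
  equidiff f p -> equidiff phi (fun i => f i (p i)) -> equidiff (fun i x => phi i (f i x)) p.
Proof.
  intros Hf Hg.
  destruct (equidiff_common f p phi _ Hf Hg) as [L [L' [K [d [HK [Hd H]]]]]].
  apply equidiff_intro with (fun i h => L' i (L i h)) (5 * (K * K * K)) (d / (2 * K)).
  - apply Rdiv_lt_0_compat; lra.
  - intro i; destruct (H i) as [H0 H1].
    exact (expansion_comp K d (f i) (p i) (L i) (phi i) (L' i) HK Hd H0 H1).
Qed.

Lemma equidiff_bound f p : equidiff f p -> exists M, forall i, Cmod (f i (p i)) <= M.
Proof.
  intros [L [K [d [_ [_ H]]]]]; exists K; intro i; apply (H i).
Qed.

End Equidiff.

Lemma equidiff_fst {I : Type} {E : NormedModule C_AbsRing} (f : I -> E -> C) (u : I -> E * C) :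
  equidiff f (fun i => fst (u i)) ->
  equidiff (fun i (x : prod_NormedModule C_AbsRing E C_NormedModule) => f i (fst x)) u.
Proof.
  intros [L [K [d [HK [Hd H]]]]].
  apply equidiff_intro with (fun i x => L i (fst x)) K d; [lra|].
  assert (N : forall x : prod_NormedModule C_AbsRing E C_NormedModule, norm (fst x) <= norm x)
    by (intro x; apply norm_le_prod_norm_1).
  intro i; destruct (H i) as [[H1 [H2 H3]] [H4 H5]].
  split; [|split].
  - split; [intros; apply H1|]; split; [intros; apply H2|].
    intro x; eapply Rle_trans; [apply H3|]; apply Rmult_le_compat_l; [lra | apply N].
  - exact H4.
  - intros h Hh; eapply Rle_trans; [apply H5; generalize (N h); lra|].
    apply Rmult_le_compat_l; [lra|]; apply pow_incr; split; [apply norm_ge_0 | apply N].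
Qed.

Section Elementary.

Context {I : Type}.

Lemma clinear_scale (c : C) (K : R) :
  Cmod c <= K -> clinear (E := C_NormedModule) K (fun k => (c * k)%C).
Proof.
  intro H; split; [|split].
  - intros x y; change (plus x y) with (x + y)%C; ring.
  - intros a x; change (scal a x) with (a * x)%C; ring.
  - intro x; rewrite Cmod_mult; change (norm x) with (Cmod x).
    apply Rmult_le_compat_r; [apply Cmod_ge_0 | exact H].
Qed.

Lemma equidiff_Cexp (M : R) (u : I -> C) :
  (forall i, Cmod (u i) <= M) -> equidiff (fun _ => Cexp : C_NormedModule -> C) u.
Proof.
  intros Hu.
  apply equidiff_intro with (fun i k => Cexp (u i) * k)%C (4 * exp (M + 1)) 1; [lra|].
  intro i; specialize (Hu i).
  assert (B : Cmod (Cexp (u i)) <= exp M).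
  { eapply Rle_trans; [apply Cmod_Cexp_le | now apply exp_le]. }
  generalize (exp_pos M), (exp_pos 1), (exp_ineq1_le 1); intros P P1 P2.
  split; [|split].
  - apply clinear_scale; rewrite exp_plus; nra.
  - rewrite exp_plus; nra.
  - intros k Hk; change (plus (u i) k) with (u i + k)%C; change (norm k) with (Cmod k) in *.
    rewrite Cexp_plus.
    replace (Cexp (u i) * Cexp k - Cexp (u i) - Cexp (u i) * k)%C
      with (Cexp (u i) * (Cexp k - 1 - k))%C by ring.
    rewrite Cmod_mult, exp_plus.
    generalize (Cexp_taylor1 k), (exp_le (Cmod k) 1 ltac:(lra)), (pow2_ge_0 (Cmod k)).
    intros T1 T2 T3.
    apply Rle_trans with (exp M * (4 * Cmod k ^ 2 * exp 1)); [|right; ring].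
    apply Rmult_le_compat; try apply Cmod_ge_0; [exact B|].
    eapply Rle_trans; [apply T1|]; apply Rmult_le_compat_l; lra.
Qed.

Lemma equidiff_Cinv (c : R) (u : I -> C) :
  0 < c -> (forall i, c <= Cmod (u i)) -> equidiff (fun _ => Cinv : C_NormedModule -> C) u.
Proof.
  intros Hc Hu.
  set (r := / c).
  assert (Hr : 0 < r) by now apply Rinv_0_lt_compat.
  apply equidiff_intro with (fun i k => (- (/ u i * / u i)) * k)%C
    (r + r * r + 2 * (r * r * r)) (c / 2); [lra|].
  intro i; specialize (Hu i).
  assert (N0 : u i <> 0%C) by (apply Cmod_gt_0; lra).
  assert (B : Cmod (/ u i) <= r).
  { rewrite Cmod_inv by exact N0; now apply Rinv_le_contravar. }
  generalize (Cmod_ge_0 (/ u i)); intro B0.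
  assert (r2 : 0 < r * r) by nra. assert (r3 : 0 < r * r * r) by nra.
  split; [|split].
  - apply clinear_scale; rewrite Cmod_opp, Cmod_mult; nra.
  - lra.
  - intros k Hk; change (plus (u i) k) with (u i + k)%C; change (norm k) with (Cmod k) in *.
    assert (Hk2 : c / 2 <= Cmod (u i + k)).
    { generalize (Cmod_minus_le (u i + k) k).
      replace (u i + k - k)%C with (u i) by ring; lra. }
    assert (N1 : (u i + k)%C <> 0%C) by (apply Cmod_gt_0; lra).
    replace (/ (u i + k) - / u i - - (/ u i * / u i) * k)%C
      with (k * k * (/ u i * / u i * / (u i + k)))%C by (field; auto).
    assert (B1 : Cmod (/ (u i + k)) <= 2 * r).
    { rewrite Cmod_inv by exact N1; unfold r.
      replace (2 * / c) with (/ (c / 2)) by (field; lra).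
      apply Rinv_le_contravar; lra. }
    rewrite !Cmod_mult.
    assert (T : Cmod (/ u i) * Cmod (/ u i) * Cmod (/ (u i + k)) <= r * r * (2 * r)).
    { apply Rmult_le_compat; auto; try apply Cmod_ge_0; [nra|].
      apply Rmult_le_compat; auto. }
    generalize (Cmod_ge_0 k); intro; nra.
Qed.

End Elementary.

(** The factor [j] gained at each differentiation is absorbed by the
    exponential decay in [j]. *)
Lemma equidiff_geometric (lambda0 : C) :
  0 < Re lambda0 ->
  equidiff (fun (j : nat) (l : C_NormedModule) => Cexp (- (RtoC (INR j) * l)))
    (fun _ => lambda0).
Proof.
  intro Hl; set (c := Re lambda0) in *; set (r := / c).
  assert (Hr : 0 < r) by now apply Rinv_0_lt_compat.
  assert (Hrc : r * c = 1) by (unfold r; field; lra).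
  apply equidiff_intro with (fun j k => (- (RtoC (INR j)) * Cexp (- (RtoC (INR j) * lambda0))) * k)%C
    (1 + r + 64 * (r * r)) (c / 2); [lra|].
  intro j; generalize (pos_INR j); set (x := INR j); intro Hx.
  assert (B : Cmod (Cexp (- (RtoC x * lambda0))) = exp (- (x * c))).
  { rewrite Cmod_Cexp; f_equal; unfold c; destruct lambda0; simpl; ring. }
  assert (Hxc : 0 <= x * c) by nra.
  assert (Ex : x * exp (- (x * c)) <= r).
  { assert (T : x * c * exp (- (x * c)) <= 1).
    { generalize (exp_ineq1_le (x * c)), (exp_pos (- (x * c))); intros T1 T2.
      assert (T3 : exp (x * c) * exp (- (x * c)) = 1)
        by (rewrite <- exp_plus, Rplus_opp_r; apply exp_0).
      nra. }
    replace (x * exp (- (x * c))) with (r * (x * c * exp (- (x * c)))); [nra|].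
    transitivity (r * c * (x * exp (- (x * c)))); [ring | rewrite Hrc; ring]. }
  split; [|split].
  - apply clinear_scale; rewrite Cmod_mult, Cmod_opp, Cmod_R, B, Rabs_right by lra; nra.
  - rewrite B.
    assert (exp (- (x * c)) <= 1) by (rewrite <- exp_0; apply exp_le; lra); nra.
  - intros k Hk; change (plus lambda0 k) with (lambda0 + k)%C; change (norm k) with (Cmod k) in *.
    replace (- (RtoC x * (lambda0 + k)))%C with (- (RtoC x * lambda0) + - (RtoC x * k))%C by ring.
    rewrite Cexp_plus; set (e := Cexp (- (RtoC x * lambda0))) in *.
    replace (e * Cexp (- (RtoC x * k)) - e - - RtoC x * e * k)%C
      with (e * (Cexp (- (RtoC x * k)) - 1 - - (RtoC x * k)))%C by ring.
    rewrite Cmod_mult, B.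
    assert (Hm : Cmod (- (RtoC x * k)) = x * Cmod k)
      by (rewrite Cmod_opp, Cmod_mult, Cmod_R, Rabs_right; lra).
    generalize (Cexp_taylor1 (- (RtoC x * k))); rewrite Hm; intro T.
    generalize (Cmod_ge_0 k); intro K0.
    assert (T1 : exp (x * Cmod k) <= exp (x * c / 2)) by (apply exp_le; nra).
    assert (T2 : exp (- (x * c)) * exp (x * c / 2)
                 = exp (- (x * c / 4)) * exp (- (x * c / 4))).
    { rewrite <- !exp_plus; f_equal; field. }
    assert (T3 : x * exp (- (x * c / 4)) <= 4 * r).
    { assert (T3 : x * c / 4 * exp (- (x * c / 4)) <= 1).
      { generalize (exp_ineq1_le (x * c / 4)), (exp_pos (- (x * c / 4))); intros U1 U2.
        assert (U3 : exp (x * c / 4) * exp (- (x * c / 4)) = 1)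
          by (rewrite <- exp_plus, Rplus_opp_r; apply exp_0).
        nra. }
      replace (x * exp (- (x * c / 4))) with (4 * r * (x * c / 4 * exp (- (x * c / 4)))); [nra|].
      transitivity (r * c * (x * exp (- (x * c / 4)))); [field | rewrite Hrc; ring]. }
    generalize (exp_pos (- (x * c))), (exp_pos (- (x * c / 4))); intros P1 P2.
    apply Rle_trans with (exp (- (x * c)) * (4 * (x * Cmod k) ^ 2 * exp (x * c / 2))).
    { apply Rmult_le_compat_l; [lra|]; eapply Rle_trans; [apply T|].
      apply Rmult_le_compat_l; [|exact T1]; generalize (pow2_ge_0 (x * Cmod k)); lra. }
    replace (exp (- (x * c)) * (4 * (x * Cmod k) ^ 2 * exp (x * c / 2)))
      with (4 * (x * exp (- (x * c / 4))) ^ 2 * Cmod k ^ 2).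
    2: { transitivity (4 * (x * Cmod k) ^ 2 * (exp (- (x * c / 4)) * exp (- (x * c / 4))));
         [ring | rewrite <- T2; ring]. }
    apply Rmult_le_compat_r; [apply pow2_ge_0|].
    assert (0 <= x * exp (- (x * c / 4))) by nra.
    nra.
Qed.

Lemma equidiff_Cexp_comp {I : Type} {E : NormedModule C_AbsRing} (f : I -> E -> C) (p : I -> E) :
  equidiff f p -> equidiff (fun i x => Cexp (f i x)) p.
Proof.
  intro Hf; destruct (equidiff_bound f p Hf) as [M HM].
  apply (equidiff_comp f p (fun _ => Cexp) Hf); now apply equidiff_Cexp with M.
Qed.

Lemma equidiff_Cinv_comp {I : Type} {E : NormedModule C_AbsRing} (c : R)
    (f : I -> E -> C) (p : I -> E) :
  0 < c -> (forall i, c <= Cmod (f i (p i))) ->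
  equidiff f p -> equidiff (fun i x => / f i x)%C p.
Proof.
  intros Hc Hb Hf.
  apply (equidiff_comp f p (fun _ => Cinv) Hf); now apply equidiff_Cinv with c.
Qed.

Lemma equidiff_reindex {I J : Type} {E : NormedModule C_AbsRing} (phi : J -> I)
    (f : I -> E -> C) (p : I -> E) :
  equidiff f p -> equidiff (fun j => f (phi j)) (fun j => p (phi j)).
Proof.
  intros [L [K [d [HK [Hd H]]]]].
  exists (fun j => L (phi j)), K, d; split; [exact HK|]; split; [exact Hd|].
  intro j; apply H.
Qed.

(** * Backward recursions preserve equidifferentiability *)

(** Iterating the inequality [n] times gives [x j <= 2 c + (M - 2 c) / 2^n]. *)
Lemma backward_bound (x : nat -> R) (c M : R) :
  (forall j, x j <= M) -> (forall j, x j <= c + / 2 * x (S j)) ->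
  forall j, x j <= 2 * c.
Proof.
  intros HM Hx.
  assert (H : forall n j, x j <= 2 * c + (/ 2) ^ n * (M - 2 * c)).
  { induction n as [|n IH]; intro j; simpl.
    - specialize (HM j); lra.
    - specialize (Hx j); specialize (IH (S j)); lra. }
  intro j; apply le_epsilon; intros eps He.
  destruct (pow_half_small (M - 2 * c) eps He) as [N HN].
  specialize (HN N (Nat.le_refl N)); specialize (H N j); lra.
Qed.

(** For each [h] the affine maps [w => A_j h + B_j w] contract the disc of
    radius [2 K |h|], so the solution is a nested limit.  Bounded solutions are
    unique, which makes it linear in [h]. *)
Lemma backward_linear_solution {E : NormedModule C_AbsRing} (K : R)
    (A : nat -> E -> C) (B : nat -> C) :
  0 <= K -> (forall j, clinear K (A j)) -> (forall j, Cmod (B j) <= / 2) ->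
  exists L : nat -> E -> C,
    (forall j, clinear (2 * K) (L j)) /\
    (forall j h, L j h = (A j h + B j * L (S j) h)%C).
Proof.
  intros HK HA HB.
  set (T := fun h j i w => (A (j + i)%nat h + B (j + i)%nat * w)%C).
  set (L := fun j h => nest_lim (T h j)).
  assert (HT : forall h j, contracting (2 * K * norm h) (T h j)).
  { intros h j; split.
    - intros i w Hw; unfold T; eapply Rle_trans; [apply Cmod_triangle|].
      rewrite Cmod_mult.
      generalize (proj2 (proj2 (HA (j + i)%nat)) h), (HB (j + i)%nat),
        (Cmod_ge_0 (B (j + i)%nat)), (Cmod_ge_0 w); nra.
    - intros i w w' _ _; unfold T.
      replace (A (j + i)%nat h + B (j + i)%nat * w - (A (j + i)%nat h + B (j + i)%nat * w'))%C
        with (B (j + i)%nat * (w - w'))%C by ring.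
      rewrite Cmod_mult; apply Rmult_le_compat_r; [apply Cmod_ge_0 | apply HB]. }
  assert (H0 : forall h : E, 0 <= 2 * K * norm h).
  { intro h; generalize (norm_ge_0 h); nra. }
  assert (HLb : forall j h, Cmod (L j h) <= 2 * K * norm h).
  { intros j h; now apply nest_lim_bound. }
  assert (HL : forall j h, L j h = (A j h + B j * L (S j) h)%C).
  { intros j h; unfold L; rewrite (nest_lim_unfold _ _ (H0 h) (HT h j)).
    replace (fun i => T h j (S i)) with (T h (S j)).
    - unfold T at 1; now rewrite Nat.add_0_r.
    - apply functional_extensionality; intro i; unfold T; now rewrite Nat.add_succ_r. }
  (* By [backward_bound] with [c = 0]; this uniqueness forces the linearity of [L]. *)
  assert (HU : forall (x : nat -> C) M, (forall j, Cmod (x j) <= M) ->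
    (forall j, x j = (B j * x (S j))%C) -> forall j, x j = 0%C).
  { intros x M HM Hx j; apply Cmod_eq_0.
    apply Rle_antisym; [|apply Cmod_ge_0].
    replace 0 with (2 * 0) by ring.
    apply (backward_bound (fun j => Cmod (x j)) 0 M HM).
    intro i; rewrite (Hx i), Cmod_mult.
    generalize (HB i), (Cmod_ge_0 (x (S i))); nra. }
  exists L; split; [|exact HL].
  intro j; split; [|split].
  - intros x y.
    assert (E0 : (L j (plus x y) - (L j x + L j y))%C = 0%C).
    { revert j; apply HU with (2 * K * norm (plus x y) + (2 * K * norm x + 2 * K * norm y)).
      - intro j; eapply Rle_trans; [apply Cmod_minus_le|].
        generalize (HLb j (plus x y)), (HLb j x), (HLb j y), (Cmod_triangle (L j x) (L j y)); lra.
      - intro j; rewrite (HL j (plus x y)), (HL j x), (HL j y), (proj1 (HA j)); ring. }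
    replace (L j (plus x y)) with (L j (plus x y) - (L j x + L j y) + (L j x + L j y))%C by ring.
    rewrite E0; ring.
  - intros c x.
    assert (E0 : (L j (scal c x) - c * L j x)%C = 0%C).
    { revert j; apply HU with (2 * K * norm (scal c x) + Cmod c * (2 * K * norm x)).
      - intro j; eapply Rle_trans; [apply Cmod_minus_le|]; rewrite Cmod_mult.
        apply Rplus_le_compat; [apply HLb|].
        apply Rmult_le_compat_l; [apply Cmod_ge_0 | apply HLb].
      - intro j; rewrite (HL j (scal c x)), (HL j x), (proj1 (proj2 (HA j))); ring. }
    replace (L j (scal c x)) with (L j (scal c x) - c * L j x + c * L j x)%C by ring.
    rewrite E0; ring.
  - exact (HLb j).
Qed.

Section Recursion.

Context {E : NormedModule C_AbsRing}.
Let EC := prod_NormedModule C_AbsRing E C_NormedModule.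

Lemma norm_pair_le (h : E) (k : C) : norm ((h, k) : EC) <= 2 * (norm h + Cmod k).
Proof.
  eapply Rle_trans; [apply (norm_prod (V := C_NormedModule) h k)|].
  change (norm (k : C_NormedModule)) with (Cmod k).
  assert (S2 : sqrt 2 <= 2).
  { rewrite <- (sqrt_pow2 2) at 2 by lra; apply sqrt_le_1; lra. }
  generalize (norm_ge_0 h), (Cmod_ge_0 k), (sqrt_pos 2); intros.
  assert (Rmax (norm h) (Cmod k) <= norm h + Cmod k) by (apply Rmax_lub; lra).
  assert (0 <= Rmax (norm h) (Cmod k)) by (eapply Rle_trans; [|apply Rmax_l]; lra).
  nra.
Qed.

(** A Lipschitz constant bounds the derivative; evaluating the expansion at a
    small real step leaves room between [1/4] and [1/2] for the remainder. *)
Lemma expansion_partial_small (K d : R) (Q : EC -> C) (p : E) (w : C) (D : EC -> C) :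
  1 <= K -> 0 < d <= 1 -> Cmod w <= 1 -> expansion K d Q (p, w) D ->
  (forall w', Cmod w' <= 2 -> Cmod (Q (p, w') - Q (p, w)) <= / 4 * Cmod (w' - w)) ->
  Cmod (D (zero, RtoC 1)) <= / 2.
Proof.
  intros HK Hd Hw [HD [_ HQ]] Hlip.
  set (t := d / (16 * K)).
  assert (Ht0 : 0 < t) by (apply Rdiv_lt_0_compat; lra).
  assert (HtK : t * (16 * K) = d) by (unfold t; field; lra).
  assert (Ht : t <= / 16 * d) by nra.
  assert (Hct : Cmod (RtoC t) = t) by (rewrite Cmod_R, Rabs_right; lra).
  assert (E1 : D (zero, RtoC t) = (RtoC t * D (zero, RtoC 1))%C).
  { rewrite <- (proj1 (proj2 HD)); f_equal.
    change ((zero, RtoC t) = (scal (RtoC t : C_AbsRing) (zero : E), (RtoC t * 1)%C)).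
    f_equal; [symmetry; exact (scal_zero_r (V := E) (RtoC t : C_AbsRing)) | ring]. }
  assert (N : norm ((zero, RtoC t) : EC) <= 2 * t).
  { eapply Rle_trans; [apply norm_pair_le | rewrite norm_zero, Hct; lra]. }
  specialize (HQ (zero, RtoC t) ltac:(lra)).
  assert (EQ : plus ((p, w) : EC) (zero, RtoC t) = (p, (w + RtoC t)%C)).
  { change ((plus p zero, (w + RtoC t)%C) = (p, (w + RtoC t)%C)); now rewrite plus_zero_r. }
  rewrite EQ in HQ.
  specialize (Hlip (w + RtoC t)%C).
  replace (w + RtoC t - w)%C with (RtoC t) in Hlip by ring; rewrite Hct in Hlip.
  assert (Hl : Cmod (Q (p, (w + RtoC t)%C) - Q (p, w)) <= / 4 * t).
  { apply Hlip; eapply Rle_trans; [apply Cmod_triangle|]; lra. }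
  assert (N0 := norm_ge_0 ((zero, RtoC t) : EC)).
  assert (N2 : norm ((zero, RtoC t) : EC) ^ 2 <= 4 * t * t) by nra.
  assert (T : Cmod (D (zero, RtoC t)) <= / 4 * t + K * (4 * t * t)).
  { replace (D (zero, RtoC t)) with
      ((Q (p, (w + RtoC t)%C) - Q (p, w))
       - (Q (p, (w + RtoC t)%C) - Q (p, w) - D (zero, RtoC t)))%C by ring.
    eapply Rle_trans; [apply Cmod_minus_le|].
    apply Rplus_le_compat; [exact Hl|].
    eapply Rle_trans; [apply HQ|]; apply Rmult_le_compat_l; lra. }
  rewrite E1, Cmod_mult, Hct in T.
  assert (K * (4 * t * t) <= / 4 * t) by nra.
  apply Rmult_le_reg_l with t; lra.
Qed.

(** Differentiating the recursion formally gives a contracting linear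
    recursion for the derivatives; its bounded solution is the derivative of
    [b], since increments and then remainders obey recursions of the same kind. *)
Lemma equidiff_recursion (Q : nat -> EC -> C) (p : E) (b : nat -> E -> C) (r : R) :
  0 < r ->
  equidiff Q (fun j => (p, b (S j) p) : EC) ->
  (forall h j, norm h < r -> Cmod (b j (plus p h)) <= 1) ->
  (forall h j, norm h < r -> b j (plus p h) = Q j (plus p h, b (S j) (plus p h))) ->
  (forall h j w w', norm h < r -> Cmod w <= 2 -> Cmod w' <= 2 ->
     Cmod (Q j (plus p h, w) - Q j (plus p h, w')) <= / 4 * Cmod (w - w')) ->
  equidiff b (fun _ => p).
Proof.
  intros Hr [D [K [d [HK [Hd HQ]]]]] Hb Hrec Hlip.
  assert (Hr0 : norm (zero : E) < r) by now rewrite norm_zero.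
  assert (Hb0 : forall j, Cmod (b j p) <= 1).
  { intro j; rewrite <- (plus_zero_r p); now apply Hb. }
  assert (Hrec0 : forall j, b j p = Q j (p, b (S j) p)).
  { intro j; specialize (Hrec zero j Hr0); now rewrite plus_zero_r in Hrec. }
  set (A := fun j h => D j (h, RtoC 0)).
  set (B := fun j => D j (zero, RtoC 1)).
  assert (HD : forall j h (k : C), D j (h, k) = (A j h + B j * k)%C).
  { intros j h k; destruct (HQ j) as [[D1 [D2 _]] _]; unfold A, B.
    rewrite (Cmult_comm _ k), <- D2, <- D1; f_equal.
    change ((h, k) = (plus h (scal (k : C_AbsRing) (zero : E)), (0 + k * 1)%C)).
    f_equal; [|now rewrite Cmult_1_r, Cplus_0_l].
    transitivity (plus h zero); [symmetry; apply plus_zero_r|].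
    f_equal; symmetry; exact (scal_zero_r (V := E) (k : C_AbsRing)). }
  assert (HA : forall j, clinear (2 * K) (A j)).
  { intro j; destruct (HQ j) as [[D1 [D2 D3]] _]; unfold A; split; [|split].
    - intros x y; rewrite <- D1; f_equal.
      change ((plus x y, RtoC 0) = (plus x y, (0 + 0)%C)); now rewrite Cplus_0_r.
    - intros c x; rewrite <- D2; f_equal.
      change ((scal c x, RtoC 0) = (scal c x, (c * 0)%C)); now rewrite Cmult_0_r.
    - intro x; eapply Rle_trans; [apply D3|].
      apply Rle_trans with (K * (2 * (norm x + 0))); [|lra].
      apply Rmult_le_compat_l; [lra|].
      eapply Rle_trans; [apply norm_pair_le | rewrite Cmod_0; lra]. }
  assert (HB : forall j, Cmod (B j) <= / 2).
  { intro j; apply (expansion_partial_small K d (Q j) p (b (S j) p)); auto.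
    intros w' Hw'; generalize (Hlip zero j w' (b (S j) p) Hr0 Hw'); rewrite plus_zero_r.
    intro H; apply H; generalize (Hb0 (S j)); lra. }
  destruct (backward_linear_solution (2 * K) A B ltac:(lra) HA HB) as [L [HL HLrec]].
  assert (Hd' : d / (20 * K) * (20 * K) = d) by (field; lra).
  assert (Hd0 : 0 < d / (20 * K)) by (apply Rdiv_lt_0_compat; lra).
  apply equidiff_intro with L (1000 * (K * K * K)) (Rmin r (d / (20 * K)));
    [now apply Rmin_pos|].
  assert (K2 : 1 <= K * K) by nra.
  assert (K3 : K * K <= K * K * K) by nra.
  intro j; split; [|split].
  - apply clinear_le with (2 * (2 * K)); [nra | apply HL].
  - generalize (Hb0 j); lra.
  - intros h Hh; revert j.
    generalize (Rmin_l r (d / (20 * K))), (Rmin_r r (d / (20 * K))); intros R1 R2.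
    assert (Hhr : norm h < r) by lra.
    assert (Hh0 := norm_ge_0 h).
    assert (Hhd : norm h * (20 * K) < d) by nra.
    set (D' := fun j => (b j (plus p h) - b j p)%C).
    assert (HDb : forall j, Cmod (D' j) <= 2).
    { intro j; unfold D'; eapply Rle_trans; [apply Cmod_minus_le|].
      generalize (Hb h j Hhr), (Hb0 j); lra. }
    assert (Hstep : forall j k, plus ((p, b (S j) p) : EC) (h, k) = (plus p h, (b (S j) p + k)%C))
      by reflexivity.
    (* First the increments: a Lipschitz bound uniform in [j], obtained from the
       same recursion with a source linear in [h]. *)
    assert (HDl : forall j, Cmod (D' j) <= 2 * (4 * K * norm h)).
    { apply (backward_bound _ _ 2 HDb); intro j.
      replace (D' j) with
        ((Q j (plus p h, b (S j) (plus p h)) - Q j (plus p h, b (S j) p))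
         + (Q j (plus p h, b (S j) p) - Q j (p, b (S j) p)))%C
        by (unfold D'; rewrite (Hrec h j Hhr), (Hrec0 j); ring).
      assert (T1 : Cmod (Q j (plus p h, b (S j) (plus p h)) - Q j (plus p h, b (S j) p))
                   <= / 4 * Cmod (D' (S j))).
      { apply Hlip; [exact Hhr | generalize (Hb h (S j) Hhr); lra
                    | generalize (Hb0 (S j)); lra]. }
      assert (N : norm ((h, RtoC 0) : EC) <= 2 * norm h)
        by (eapply Rle_trans; [apply norm_pair_le | rewrite Cmod_0; lra]).
      assert (T2 : Cmod (Q j (plus p h, b (S j) p) - Q j (p, b (S j) p)) <= 4 * K * norm h).
      { generalize (expansion_increment K d (Q j) _ (D j) (h, RtoC 0) HK (proj2 Hd) (HQ j)
          ltac:(nra)).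
        rewrite Hstep; replace (b (S j) p + 0)%C with (b (S j) p) by ring; nra. }
      eapply Rle_trans; [apply Cmod_triangle|].
      generalize (Cmod_ge_0 (D' (S j))); lra. }
    (* Then the remainders, whose source is the Taylor remainder of [Q j] at a
       displacement of norm at most [18 * K * norm h]. *)
    intro j.
    apply Rle_trans with (2 * (K * (18 * K * norm h) ^ 2)).
    2: { generalize (pow2_ge_0 (norm h)); nra. }
    revert j; apply (backward_bound (fun j => Cmod (D' j - L j h)) _ (2 + 2 * (2 * K) * norm h)).
    + intro j; eapply Rle_trans; [apply Cmod_minus_le|].
      apply Rplus_le_compat; [apply HDb | apply HL].
    + intro j.
      replace (D' j - L j h)%C with
        ((Q j (plus p h, b (S j) (plus p h)) - Q j (p, b (S j) p) - D j (h, D' (S j)))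
         + B j * (D' (S j) - L (S j) h))%C
        by (rewrite HD, (HLrec j h); unfold D' at 3; rewrite (Hrec h j Hhr), (Hrec0 j); ring).
      eapply Rle_trans; [apply Cmod_triangle|].
      apply Rplus_le_compat.
      * assert (N : norm ((h, D' (S j)) : EC) <= 18 * K * norm h).
        { eapply Rle_trans; [apply norm_pair_le|]; generalize (HDl (S j)); nra. }
        assert (N0 := norm_ge_0 ((h, D' (S j)) : EC)).
        generalize (proj2 (proj2 (HQ j)) (h, D' (S j)) ltac:(nra)); rewrite Hstep.
        replace (b (S j) p + D' (S j))%C with (b (S j) (plus p h)) by (unfold D'; ring).
        intro T; eapply Rle_trans; [apply T|].
        apply Rmult_le_compat_l; [lra|]; apply pow_incr; lra.
      * rewrite Cmod_mult; apply Rmult_le_compat_r; [apply Cmod_ge_0 | apply HB].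
Qed.

End Recursion.

(** * Holomorphy of the limit *)

Lemma plus_minus_cancel {G : AbelianGroup} (x y : G) : plus x (minus y x) = y.
Proof.
  unfold minus; rewrite plus_comm, <- plus_assoc, (plus_comm _ x), plus_opp_r; apply plus_zero_r.
Qed.

Lemma equidiff_filterdiff {E : NormedModule C_AbsRing} (f : E -> C_NormedModule) (p : E) :
  equidiff (fun _ : unit => f) (fun _ => p) -> ex_filterdiff f (locally p).
Proof.
  intros [L [K [d [HK [Hd H]]]]].
  destruct (H tt) as [[L1 [L2 L3]] [_ H3]].
  exists (L tt); split.
  - split; [exact L1 | exact L2 | exists K; split; [lra | exact L3]].
  - intros x Hx; apply is_filter_lim_locally_unique in Hx; subst x.
    intro eps; apply locally_le_locally_norm.
    assert (Hm : 0 < Rmin d (eps / K)).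
    { apply Rmin_pos; [lra|]; apply Rdiv_lt_0_compat; [apply cond_pos | lra]. }
    exists (mkposreal _ Hm); intros y Hy; unfold ball_norm in Hy; simpl in Hy.
    set (h := minus y p) in *.
    assert (Ey : y = plus p h).
    { symmetry; exact (plus_minus_cancel (G := E) p y). }
    generalize (Rmin_l d (eps / K)), (Rmin_r d (eps / K)); intros R1 R2.
    rewrite Ey.
    change (Cmod (f (plus p h) - f p - L tt h) <= eps * norm h).
    eapply Rle_trans; [apply H3; lra|].
    assert (Q : norm h < eps / K) by lra.
    apply (Rmult_lt_compat_r K) in Q; [|lra].
    unfold Rdiv in Q; rewrite Rmult_assoc, Rinv_l, Rmult_1_r in Q by lra.
    generalize (norm_ge_0 h); nra.
Qed.

Lemma equidiff_neq_0_near {E : NormedModule C_AbsRing} (f : E -> C) (p : E) :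
  equidiff (fun _ : unit => f) (fun _ => p) -> f p <> 0%C ->
  exists d, 0 < d /\ forall h, norm h < d -> f (plus p h) <> 0%C.
Proof.
  intros [L [K [d [HK [Hd H]]]]] H0; specialize (H tt).
  apply Cmod_gt_0 in H0.
  exists (Rmin d (Cmod (f p) / (2 * K))); split.
  - apply Rmin_pos; [lra | apply Rdiv_lt_0_compat; lra].
  - intros h Hh Hz.
    generalize (Rmin_l d (Cmod (f p) / (2 * K))), (Rmin_r d (Cmod (f p) / (2 * K))); intros R1 R2.
    generalize (expansion_increment K d f p (L tt) h HK (proj2 Hd) H ltac:(lra)).
    rewrite Hz; replace (0 - f p)%C with (- f p)%C by ring; rewrite Cmod_opp.
    assert (Q : norm h < Cmod (f p) / (2 * K)) by lra.
    apply (Rmult_lt_compat_r (2 * K)) in Q; [|lra].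
    unfold Rdiv in Q; rewrite Rmult_assoc, Rinv_l, Rmult_1_r in Q by lra.
    lra.
Qed.

(** The excluded parameters are exactly the poles of the coefficients. *)
Lemma LL_denominators (s lambda : C) :
  LL s lambda <->
  0 < Re lambda /\
  forall j : nat, (1 <= j)%nat -> (1 + Cexp (lambda * (RtoC (INR j) - s)))%C <> 0%C.
Proof.
  split; intros [Hl H]; split; try exact Hl.
  - intros j Hj H0.
    destruct (Cexp_eq_m1 (lambda * (RtoC (INR j) - s))) as [k Hk].
    { replace (Cexp (lambda * (RtoC (INR j) - s)))
        with (1 + Cexp (lambda * (RtoC (INR j) - s)) - 1)%C by ring.
      rewrite H0; ring. }
    apply (H (Z.of_nat j) k); [lia|].
    now rewrite <- INR_IZR_INZ.
  - intros j k Hj H0.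
    apply (H (Z.to_nat j)); [lia|].
    rewrite INR_IZR_INZ, Z2Nat.id, H0, Cexp_pole by lia; ring.
Qed.

Definition Param : NormedModule C_AbsRing :=
  prod_NormedModule C_AbsRing
    (prod_NormedModule C_AbsRing C_NormedModule C_NormedModule) C_NormedModule.

Definition par_s (x : Param) : C := fst (fst x).
Definition par_lambda (x : Param) : C := snd (fst x).
Definition par_mu (x : Param) : C := snd x.

Lemma clinear_par_s : clinear 1 par_s.
Proof.
  split; [|split]; try (intros; reflexivity); intro x; rewrite Rmult_1_l.
  eapply Rle_trans; [|apply norm_le_prod_norm_1].
  apply (norm_le_prod_norm_1 (U := C_NormedModule) (V := C_NormedModule) (fst x)).
Qed.

Lemma clinear_par_lambda : clinear 1 par_lambda.
Proof.
  split; [|split]; try (intros; reflexivity); intro x; rewrite Rmult_1_l.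
  eapply Rle_trans; [|apply norm_le_prod_norm_1].
  apply (norm_le_prod_norm_2 (U := C_NormedModule) (V := C_NormedModule) (fst x)).
Qed.

Lemma clinear_par_mu : clinear 1 par_mu.
Proof.
  split; [|split]; try (intros; reflexivity); intro x; rewrite Rmult_1_l.
  apply (norm_le_prod_norm_2 (V := C_NormedModule) x).
Qed.

Section Holomorphy.

Variable p0 : Param.
Hypothesis Hre : 0 < Re (par_lambda p0).

Lemma equidiff_coordinate {I : Type} (L : Param -> C) :
  clinear 1 L -> equidiff (fun _ : I => L) (fun _ => p0).
Proof.
  intro HL; now apply equidiff_linear with 1 (Cmod (L p0)); [|intro; right].
Qed.

Lemma coordinate_near (L : Param -> C) (d : R) (h : Param) :
  clinear 1 L -> norm h < d -> Cmod (L (plus p0 h) - L p0) < d.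
Proof.
  intros [H1 [_ H2]] Hh; rewrite H1.
  replace (L p0 + L h - L p0)%C with (L h) by ring; specialize (H2 h); lra.
Qed.

Lemma weights_small_near (eps : R) :
  0 < eps ->
  exists (N : nat) (d : R), 0 < d /\ forall h, norm h < d ->
    0 < Re (par_lambda (plus p0 h)) /\
    forall j, (N <= j)%nat ->
      Cmod (weight (par_s (plus p0 h)) (par_lambda (plus p0 h)) j) <= eps.
Proof.
  intro He.
  destruct (weight_small (par_s p0) (par_lambda p0) eps Hre He) as [N [d [Hd H]]].
  exists N, d; split; [exact Hd|]; intros h Hh.
  apply H; apply coordinate_near; auto using clinear_par_s, clinear_par_lambda.
Qed.

Lemma equidiff_weight :
  equidiff (fun (j : nat) x => weight (par_s x) (par_lambda x) j) (fun _ => p0).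
Proof.
  apply equidiff_ext_near with (d := 1)
    (f := fun j x => (Cexp (par_lambda x * par_s x) * Cexp (- (RtoC (INR j) * par_lambda x)))%C).
  - lra.
  - intros j h _; unfold weight; rewrite <- Cexp_plus; f_equal.
  - apply equidiff_mult.
    + apply equidiff_Cexp_comp, equidiff_mult; apply equidiff_coordinate;
        [apply clinear_par_lambda | apply clinear_par_s].
    + apply (equidiff_comp (fun _ : nat => par_lambda) (fun _ => p0)
        (fun j l => Cexp (- (RtoC (INR j) * l)))).
      * apply equidiff_coordinate, clinear_par_lambda.
      * now apply equidiff_geometric.
Qed.

Lemma equidiff_inv_denominator (N : nat) (d : R) :
  0 < d ->
  (forall h, norm h < d -> forall j, (N <= j)%nat ->
     Cmod (weight (par_s (plus p0 h)) (par_lambda (plus p0 h)) j) <= / 2) ->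
  equidiff (fun i x => / (1 + Cexp (par_lambda x * (RtoC (INR (S (N + i))) - par_s x))))%C
    (fun _ => p0).
Proof.
  intros Hd Hw.
  assert (W : equidiff (fun i x => weight (par_s x) (par_lambda x) (S (N + i))) (fun _ => p0)).
  { exact (equidiff_reindex (fun i => S (N + i)) _ _ equidiff_weight). }
  apply equidiff_ext_near with (d := d) (f := fun i x =>
    (weight (par_s x) (par_lambda x) (S (N + i))
     * / (1 + weight (par_s x) (par_lambda x) (S (N + i))))%C).
  - exact Hd.
  - intros i h Hh; symmetry; apply inv_denominator, one_plus_neq_0, Hw; [exact Hh | lia].
  - apply equidiff_mult; [exact W|].
    apply equidiff_Cinv_comp with (/ 2); [lra | |].
    + intro i; generalize (Hw zero ltac:(rewrite norm_zero; exact Hd) (S (N + i)) ltac:(lia)).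
      rewrite plus_zero_r; set (t := weight _ _ _); intro Ht.
      generalize (Cmod_minus_le (1 + t) t); replace (1 + t - t)%C with (RtoC 1) by ring.
      rewrite Cmod_1; lra.
    + apply equidiff_plus; [apply equidiff_const | exact W].
Qed.

(** The functions [beta (s - N - j)] are bounded by 1 and solve the backward
    recursion given by the functional equation. *)
Lemma equidiff_beta_tail :
  exists N : nat,
    equidiff (fun (_ : unit) x =>
      beta (par_lambda x) (par_mu x) (par_s x - RtoC (INR N))) (fun _ => p0).
Proof.
  set (m := Cmod (par_mu p0) + 1).
  assert (Hm : 0 <= m) by (generalize (Cmod_ge_0 (par_mu p0)); unfold m; lra).
  destruct (weights_small_near (threshold m) (threshold_pos m Hm)) as [N [d0 [Hd0 H0]]].
  set (d := Rmin d0 1).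
  assert (Hd : 0 < d) by (apply Rmin_pos; lra).
  assert (Hmu : forall h, norm h < d -> Cmod (par_mu (plus p0 h)) <= m).
  { intros h Hh; generalize (Rmin_r d0 1); fold d; intro.
    generalize (coordinate_near par_mu 1 h clinear_par_mu ltac:(lra)),
      (Cmod_triangle (par_mu (plus p0 h) - par_mu p0) (par_mu p0)).
    replace (par_mu (plus p0 h) - par_mu p0 + par_mu p0)%C with (par_mu (plus p0 h)) by ring.
    unfold m; lra. }
  assert (Hw : forall h, norm h < d -> 0 < Re (par_lambda (plus p0 h)) /\ forall j, (N <= j)%nat ->
    Cmod (weight (par_s (plus p0 h)) (par_lambda (plus p0 h)) j) <= threshold m).
  { intros h Hh; apply H0; generalize (Rmin_l d0 1); fold d; lra. }
  clearbody d; clear H0 Hd0 d0.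
  assert (Hb : forall h j, norm h < d ->
    Cmod (beta (par_lambda (plus p0 h)) (par_mu (plus p0 h))
            (par_s (plus p0 h) - RtoC (INR (N + j)))) <= 1).
  { intros h j Hh; destruct (Hw h Hh) as [Hl Hwj].
    apply beta_tail_bound; [exact Hl|]; intros k Hk.
    eapply Rle_trans; [apply Hwj; lia|].
    now apply threshold_decr; [apply Cmod_ge_0 | apply Hmu]. }
  exists N.
  set (b := fun (j : nat) (x : Param) =>
    beta (par_lambda x) (par_mu x) (par_s x - RtoC (INR (N + j)))).
  assert (HB : equidiff b (fun _ => p0)).
  2: { generalize (equidiff_reindex (fun _ : unit => 0%nat) b _ HB); unfold b.
       now rewrite Nat.add_0_r. }
  apply (equidiff_recursion (fun j x =>
    q (par_lambda (fst x)) (par_mu (fst x)) (S (N + j)) (par_s (fst x)) (snd x)) p0 b d Hd).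
  - eapply equidiff_ext_near with (d := 1) (f := fun j x =>
      (/ (1 + Cexp (par_lambda (fst x) * (RtoC (INR (S (N + j))) - par_s (fst x))))
       * Cexp (par_mu (fst x) * snd x))%C); [lra | intros; now rewrite q_factor |].
    apply equidiff_mult.
    + apply (equidiff_fst (fun j x =>
        / (1 + Cexp (par_lambda x * (RtoC (INR (S (N + j))) - par_s x))))%C).
      apply equidiff_inv_denominator with d; [exact Hd|].
      intros h Hh j Hj; eapply Rle_trans; [now apply Hw | now apply threshold_half].
    + apply equidiff_Cexp_comp, equidiff_mult.
      * apply (equidiff_fst (fun _ => par_mu)).
        apply equidiff_coordinate, clinear_par_mu.
      * apply equidiff_linear with (K := 1) (M := 1).
        -- split; [|split]; try (intros; reflexivity); intro x; rewrite Rmult_1_l.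
           apply (norm_le_prod_norm_2 (V := C_NormedModule) x).
        -- intro j; simpl; unfold b; rewrite <- (plus_zero_r p0); apply Hb.
           rewrite norm_zero; exact Hd.
  - exact Hb.
  - intros h j Hh; unfold b; simpl fst; simpl snd.
    rewrite <- plus_n_Sm; now apply beta_unfold_tail, Hw.
  - intros h j w w' Hh Hw1 Hw2; simpl fst; simpl snd.
    apply (q_small_lipschitz _ _ _ _ m); auto; apply Hw; [exact Hh | lia].
Qed.

Lemma equidiff_denominator (j : nat) :
  equidiff (fun (_ : unit) x => 1 + Cexp (par_lambda x * (RtoC (INR j) - par_s x)))%C
    (fun _ => p0).
Proof.
  apply equidiff_plus; [apply equidiff_const|].
  apply equidiff_Cexp_comp, equidiff_mult;
    [apply equidiff_coordinate, clinear_par_lambda|].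
  apply equidiff_plus; [apply equidiff_const|].
  apply equidiff_ext_near with (d := 1) (f := fun _ x => (- (1) * par_s x)%C);
    [lra | intros; ring |].
  apply equidiff_mult; [apply equidiff_const | apply equidiff_coordinate, clinear_par_s].
Qed.

Lemma equidiff_nested_q (n : nat) (g : Param -> C) :
  (forall j : nat, (1 <= j)%nat ->
     (1 + Cexp (par_lambda p0 * (RtoC (INR j) - par_s p0)))%C <> 0%C) ->
  equidiff (fun _ : unit => g) (fun _ => p0) ->
  equidiff (fun (_ : unit) x => nested_q (par_lambda x) (par_mu x) n (par_s x) (g x))
    (fun _ => p0).
Proof.
  intro H; revert g; induction n as [|n IH]; intros g Hg; simpl; [exact Hg|].
  apply (IH (fun x => q (par_lambda x) (par_mu x) (S n) (par_s x) (g x))).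
  apply equidiff_ext_near with (d := 1) (f := fun _ x =>
    (/ (1 + Cexp (par_lambda x * (RtoC (INR (S n)) - par_s x))) * Cexp (par_mu x * g x))%C);
    [lra | intros; now rewrite q_factor |].
  apply equidiff_mult.
  - eapply equidiff_Cinv_comp; [|intro; apply Rle_refl | apply equidiff_denominator].
    apply Cmod_gt_0, H; lia.
  - apply equidiff_Cexp_comp, equidiff_mult; [|exact Hg].
    apply equidiff_coordinate, clinear_par_mu.
Qed.

(** Small weights exclude the poles of large rank near [p0]; the finitely many
    remaining denominators are continuous. *)
Lemma LL_near :
  LL (par_s p0) (par_lambda p0) ->
  exists d, 0 < d /\ forall h, norm h < d -> LL (par_s (plus p0 h)) (par_lambda (plus p0 h)).
Proof.
  intro H; apply LL_denominators in H; destruct H as [_ H].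
  destruct (weights_small_near (/ 2) ltac:(lra)) as [N [d0 [Hd0 H0]]].
  assert (Hhead : forall n, exists d, 0 < d /\ forall h, norm h < d ->
    forall j, (1 <= j <= n)%nat ->
    (1 + Cexp (par_lambda (plus p0 h) * (RtoC (INR j) - par_s (plus p0 h))))%C <> 0%C).
  { induction n as [|n [d1 [Hd1 H1]]].
    - exists 1; split; [lra | intros; lia].
    - destruct (equidiff_neq_0_near _ p0 (equidiff_denominator (S n))) as [d2 [Hd2 H2]].
      { apply H; lia. }
      exists (Rmin d1 d2); split; [now apply Rmin_pos|].
      intros h Hh j Hj; generalize (Rmin_l d1 d2), (Rmin_r d1 d2); intros R1 R2.
      destruct (Nat.eq_dec j (S n)) as [->|Hjn].
      + apply H2; lra.
      + apply H1; [lra | lia]. }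
  destruct (Hhead N) as [d1 [Hd1 H1]].
  exists (Rmin d0 d1); split; [now apply Rmin_pos|].
  intros h Hh; generalize (Rmin_l d0 d1), (Rmin_r d0 d1); intros R1 R2.
  destruct (H0 h ltac:(lra)) as [Hl Hw].
  apply LL_denominators; split; [exact Hl|]; intros j Hj.
  destruct (Nat.le_gt_cases j N) as [Hn|Hn].
  - apply H1; [lra | lia].
  - apply denominator_neq_0, Hw; lia.
Qed.

Lemma equidiff_beta :
  LL (par_s p0) (par_lambda p0) ->
  equidiff (fun (_ : unit) x => beta (par_lambda x) (par_mu x) (par_s x)) (fun _ => p0).
Proof.
  intro H; apply LL_denominators in H; destruct H as [_ H].
  destruct equidiff_beta_tail as [N HN].
  destruct (weights_small_near (/ 2) ltac:(lra)) as [n [d [Hd H0]]].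
  eapply equidiff_ext_near; [exact Hd | | exact (equidiff_nested_q N _ H HN)].
  intros i h Hh; symmetry; apply beta_nested, (H0 h Hh).
Qed.

End Holomorphy.

Lemma open_LL : open (fun x : Param => LL (par_s x) (par_lambda x)).
Proof.
  intros p Hp; apply locally_le_locally_norm.
  destruct (LL_near p (proj1 Hp) Hp) as [d [Hd H]].
  exists (mkposreal d Hd); intros y Hy.
  rewrite <- (plus_minus_cancel (G := Param) p y); apply H, Hy.
Qed.

Local Open Scope C_scope.

Theorem theorem1p3p1 :
  (forall mu s lambda : C, LL s lambda ->
     forall z : C,
       filterlim (fun n : nat => nested_q lambda mu n s z) eventually
         (locally (beta lambda mu s)))
  /\
  holomorphic_on
    (fun p : C * C * C => let '(s, lambda, mu) := p in LL s lambda)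
    (fun p : C * C * C => let '(s, lambda, mu) := p in beta lambda mu s)
  /\
  (forall mu s lambda : C, LL (s + 1) lambda ->
     beta lambda mu (s + 1)
     = Cexp (mu * beta lambda mu s) / (1 + Cexp (- lambda * s))).
Proof.
  split; [|split].
  - intros mu s lambda H z; apply filterlim_Ctends, beta_tends, H.
  - split.
    + eapply open_ext; [|exact open_LL]; intros [[s lambda] mu]; reflexivity.
    + intros p Hp.
      assert (Hp' : LL (par_s p) (par_lambda p)) by (destruct p as [[s lambda] mu]; exact Hp).
      apply (equidiff_filterdiff (E := Param)).
      eapply equidiff_ext_near;
        [exact Rlt_0_1 | | exact (equidiff_beta p (proj1 Hp') Hp')].
      intros i h _; destruct (plus p h) as [[s lambda] mu]; reflexivity.
  - intros mu s lambda H; apply beta_succ, H.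
Qed.
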